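(* Let $\mathtt h=\mathrm{CH}$ be the Chow theory with coefficients in $R$ ($R=\mathbb Z$, or $2$ is not a zero-divisor in $R$). Then, inside $E_Q$, $$E_S\cap E_D^{(0)}=\mathrm{End}_{R[W]}(R[W/W_P]).$$ In particular, if $D_P^\star$ is indecomposable (as a $D$-module, with $R=\mathbb Z$), then so is the induced integral representation $\mathrm{Ind}^W_{W_P}\mathbf 1$ of the Weyl group $W$.
   Context: Let $G$ be a split reductive group over a field of characteristic $0$, $T\subset B\subset P$ a split maximal torus, Borel and standard parabolic subgroup, $T^*$ the character lattice, $\Sigma$ the root system, $\Sigma_P$ the root subsystem for $P$, $\Sigma^-,\Sigma_P^-$ the negative roots, $W$ and $W_P$ the Weyl groups, $W^P$ the set of minimal length representatives of $W/W_P$, $l$ the length function; for $w\in W$, $\overline w\in W^P$ is the minimal representative of $wW_P$. For Chow theory $S=\mathrm{Sym}_R(T^* )$ is the polynomial ring (graded with $T^*$ in degree $1$), with its $W$-action, and $x_\lambda=\lambda$. $Q$ is the localization of $S$ at all roots, $Q_W$ the free left $Q$-module on $\delta_w$, $w\in W$, with $(q\delta_w)(q'\delta_{w'})=q\,w(q')\delta_{ww'}$, $S_W\subset Q_W$ the $S$-span of the $\delta_w$, and $D\subset Q_W$ the subalgebra generated by $S$ and $X_\alpha=\alpha^{-1}(1-\delta_{s_\alpha})$, $\alpha\in\Sigma$ (the nil affine Hecke algebra). $Q_{W/W_P}$ is the free $Q$-module on $\{\delta_w\}_{w\in W^P}$; $p\colon Q_W\to Q_{W/W_P}$, $q\delta_w\mapsto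 q\delta_{\overline w}$; $D_P=p(D)$. $Q_{W/W_P}^*=\mathrm{Hom}_Q(Q_{W/W_P},Q)$ has dual basis $\{f_w\}_{w\in W^P}$; $D_P^\star=\{f\in Q_{W/W_P}^*: f(D_P)\subset S\}=\mathrm{Hom}_S(D_P,S)$; $S_{W/W_P}^\star=\bigoplus_{w\in W^P}Sf_w$; similarly $R[W/W_P]$ is identified with $\bigoplus_{w\in W^P}Rf_w$. The $\odot$-action of $Q_W$ on $Q_{W/W_P}^*$ is $q\delta_w\odot pf_v=q\,w(p)f_{\overline{wv}}$; it restricts to $D$ acting on $D_P^\star$, $S_W$ acting on $S_{W/W_P}^\star$, and $R[W]$ acting on $R[W/W_P]$ by the left permutation action. $E_Q=\mathrm{End}_{Q_W}(Q_{W/W_P}^* )$, $E_D=\mathrm{End}_D(D_P^\star)$, $E_S=\mathrm{End}_{S_W}(S_{W/W_P}^\star)$; $E_D$, $E_S$ and $\mathrm{End}_{R[W]}(R[W/W_P])$ are identified with their images in $E_Q$ under extension of scalars to $Q$. Schubert basis: for $j$ indexing the simple roots $\alpha_j$ put $X_j=X_{\alpha_j}$; $[\mathrm{pt}]=\xi_1=\big(\prod_{\alpha\in\Sigma^-\setminus\Sigma_P^-}\alpha\big)f_1\in D_P^\star$, and for $w\in W^P$ with reduced expression $w=s_{j_1}\cdots s_{j_l}$, $\xi_w=X_{j_1}\cdots X_{j_l}\odot\xi_1$; $\{\xi_w\}_{w\in W^P}$ is an $S$-basis of $D_P^\star$ (Schubert classes, of dimension $l(w)$). For $\phi\in E_D$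 write $\phi(\xi_w)=\sum_{v\in W^P}a_{v,w}\xi_v$. $E_D^{(0)}\subset E_D$ is the subring of homogeneous endomorphisms: those $\phi$ for which each $a_{v,w}\in S$ is homogeneous of degree $l(v)-l(w)$ (so zero if $l(v)<l(w)$). *)

(* Defs.v *)
From mathcomp Require Import all_boot all_order all_algebra all_fingroup.
From mathcomp Require Import mpoly.

Set Implicit Arguments.
Unset Strict Implicit.
Unset Printing Implicit Defensive.

Import GRing.Theory Num.Theory.
Local Open Scope ring_scope.

(* Split reductive groups with a split maximal torus, a Borel subgroup and a
   standard parabolic subgroup T <= B <= P enter only through their
   combinatorial data: a reduced root datum, a base of its root system, and a
   set of simple roots.

   The character lattice T^* is Z^n, as column vectors; the cocharacter lattice
   is its dual Z^n, as row vectors; the pairing <x, c> is the entry of c *m x.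
   Then 1 - a *m a^v is the matrix of the reflection s_a on characters and, by
   multiplication on the right, of the dual reflection on cocharacters. *)
Definition refl_mx n (a : 'cV[int]_n) (av : 'rV[int]_n) : 'M[int]_n :=
  1%:M - a *m av.

Record root_datum := RootDatum {
  rd_rank : nat;
  rd_ix : finType;
  root : rd_ix -> 'cV[int]_rd_rank;
  coroot : rd_ix -> 'rV[int]_rd_rank;
  root_inj : injective root;
  coroot_inj : injective coroot;
  root_coroot : forall i, (coroot i *m root i) 0 0 = 2;
  (* reflections are automorphisms of the root datum *)
  root_refl : forall i j, exists k,
    root k = refl_mx (root i) (coroot i) *m root j
    /\ coroot k = coroot j *m refl_mx (root i) (coroot i);
  root_reduced : forall i j (a b : int), a != 0 -> b != 0 ->
    root i *~ a = root j *~ b -> root i = root j \/ root i = - root j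
}.

Record base (Phi : root_datum) := Base {
  b_size : nat;
  simple : 'I_b_size -> rd_ix Phi;
  simple_free : forall c : 'I_b_size -> int,
    \sum_j root (simple j) *~ c j = 0 -> forall j, c j = 0;
  coord : rd_ix Phi -> 'I_b_size -> int;
  coord_root : forall i, root i = \sum_j root (simple j) *~ coord i j;
  coord_sign : forall i,
    (forall j, 0 <= coord i j) \/ (forall j, coord i j <= 0)
}.
Arguments coord {Phi} b i j.

(* The Weyl group: the group of automorphisms of T^* generated by the
   reflections.  It is finite for every root datum, so asking for a finGroupType
   is no restriction, and this record is unique up to unique isomorphism. *)
Record weyl_group (Phi : root_datum) := WeylGroup {
  weyl :> finGroupType;
  weyl_mx : weyl -> 'M[int]_(rd_rank Phi);
  weyl_mx1 : weyl_mx 1%g = 1%:M;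
  weyl_mxM : forall w w', weyl_mx (w * w')%g = weyl_mx w *m weyl_mx w';
  weyl_mx_inj : injective weyl_mx;
  weyl_refl : rd_ix Phi -> weyl;
  weyl_reflE : forall i, weyl_mx (weyl_refl i) = refl_mx (root i) (coroot i);
  weyl_gen : <<[set weyl_refl i | i : rd_ix Phi]>>%g = [set: weyl]
}.

Section Parabolic.

Variables (Phi : root_datum) (B : base Phi) (W : weyl_group Phi).

Definition neg_roots : {set rd_ix Phi} :=
  [set i | [forall j, coord B i j <= 0]].

Definition word_elt (t : seq 'I_(b_size B)) : W :=
  (\prod_(j <- t) weyl_refl W (simple j))%g.

(* The least length of a word in the simple reflections with product w.  The
   partial products of a shortest word are distinct, so lengths below #|W| are
   the only ones to consider. *)
Definition len (w : W) : nat :=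
  find (fun k => [exists t : k.-tuple 'I_(b_size B), word_elt t == w])
       (iota 0 #|W|).

Definition reduced_word (t : seq 'I_(b_size B)) (w : W) : Prop :=
  word_elt t = w /\ size t = len w.

(* P is given by the set J of simple roots of its Levi subgroup. *)
Variable J : {set 'I_(b_size B)}.

Definition levi_roots : {set rd_ix Phi} :=
  [set i | [forall j, (j \notin J) ==> (coord B i j == 0)]].

Definition weyl_levi : {group W} :=
  <<[set weyl_refl W i | i in levi_roots]>>%G.

Definition min_rep (w : W) : bool :=
  [forall u in weyl_levi, (len w <= len (w * u)%g)%N].

(* W^P *)
Definition WP : Type := {w : W | min_rep w}.

Definition bar_val (w : W) : W :=
  [arg min_(v < w in (w *: weyl_levi)%g) len v]%N.

Lemma bar_val_min w : min_rep (bar_val w).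
Proof.
rewrite /bar_val; case: arg_minnP => [|v vw minv]; first exact: lcoset_refl.
apply/forall_inP => u uP; apply: minv.
by case/lcosetP: vw => u' u'P ->; rewrite -mulgA mem_lcoset mulKg groupM.
Qed.

Definition bar (w : W) : WP := exist _ (bar_val w) (bar_val_min w).

End Parabolic.

Section Modules.

Variables (A : Type) (V : zmodType) (act : A -> V -> V).
(* the ring acting, and the module it acts on *)
Variables (inA : A -> Prop) (M : V -> Prop).

Definition endomorphism (phi : V -> V) : Prop :=
  (forall f, M f -> M (phi f))
  /\ (forall f g, M f -> M g -> phi (f + g) = phi f + phi g)
  /\ (forall a f, inA a -> M f -> phi (act a f) = act a (phi f)).

Definition submodule (N : V -> Prop) : Prop :=
  (forall f, N f -> M f)
  /\ N 0
  /\ (forall f g, N f -> N g -> N (f - g))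
  /\ (forall a f, inA a -> N f -> N (act a f)).

Definition indecomposable : Prop :=
  (exists f, M f /\ f <> 0)
  /\ forall N1 N2 : V -> Prop, submodule N1 -> submodule N2 ->
     (forall f, M f -> exists g h, N1 g /\ N2 h /\ f = g + h) ->
     (forall f, N1 f -> N2 f -> f = 0) ->
     (forall f, N1 f -> f = 0) \/ (forall f, N2 f -> f = 0).

End Modules.

Section SymAlg.

(* Sym_R(T^* ) is a polynomial ring in the coordinates of T^* = Z^n. *)

Variables (R : comNzRingType) (Phi : root_datum) (W : weyl_group Phi).
Local Notation S := {mpoly R[rd_rank Phi]}.

(* x_lambda *)
Definition xchar (l : 'cV[int]_(rd_rank Phi)) : S :=
  \sum_i 'X_i *~ l i 0.

Definition xroot (i : rd_ix Phi) : S := xchar (root i).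

Definition sact (w : W) (s : S) : S :=
  s \mPo [tuple xchar (col i (weyl_mx w)) | i < rd_rank Phi].

End SymAlg.

(* The localization of S at all roots, by its universal characterization;
   Q is unique up to unique isomorphism under S.  (A classical choice of the
   unit predicate turns any commutative ring into a comUnitRingType.) *)
Record root_localization (R : comNzRingType) (Phi : root_datum) :=
  RootLocalization {
  loc :> comUnitRingType;
  emb : {rmorphism {mpoly R[rd_rank Phi]} -> loc};
  emb_root_unit : forall i, emb (xroot R i) \is a GRing.unit;
  emb_frac : forall q : loc,
    exists sm : {mpoly R[rd_rank Phi]} * seq (rd_ix Phi),
    q == emb sm.1 / \prod_(i <- sm.2) emb (xroot R i);
  emb_eq0 : forall s, emb s = 0 ->
    exists m : seq (rd_ix Phi), s * \prod_(i <- m) xroot R i = 0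
}.

Section Demazure.

Variables (R : comNzRingType) (Phi : root_datum) (B : base Phi).
Variables (W : weyl_group Phi) (Q : root_localization R Phi).
Variable J : {set 'I_(b_size B)}.
Local Notation S := {mpoly R[rd_rank Phi]}.
Local Notation WP := (WP W J).
Local Notation bar := (bar J).

Definition inS (q : Q) : Prop := exists s : S, q = emb Q s.

(* The action of W on Q extending that on S, computed on some fraction
   representing q. *)
Definition qact (w : W) (q : Q) : Q :=
  let sm := xchoose (emb_frac q) in
  emb Q (sact w sm.1) / \prod_(i <- sm.2) emb Q (sact w (xroot R i)).

(* An element x of Q_W is \sum_w x w delta_w. *)
Definition QW : Type := {ffun W -> Q}.

Definition delta (q : Q) (w : W) : QW := [ffun u => if u == w then q else 0].

(* (q delta_w) (q' delta_w') = q w(q') delta_{w w'} *)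
Definition mulQW (x y : QW) : QW :=
  \sum_w \sum_w' delta (x w * qact w (y w')) (w * w')%g.

(* X_alpha = alpha^-1 (1 - delta_{s_alpha}) *)
Definition demazure (i : rd_ix Phi) : QW :=
  let a := (emb Q (xroot R i))^-1 in delta a 1%g - delta a (weyl_refl W i).

Definition inSW (x : QW) : Prop := forall w, inS (x w).

Inductive inD : QW -> Prop :=
| inD_S s : inD (delta (emb Q s) 1%g)
| inD_X i : inD (demazure i)
| inD_sub x y : inD x -> inD y -> inD (x - y)
| inD_mul x y : inD x -> inD y -> inD (mulQW x y).

(* Q_{W/W_P} in the basis delta_w, w in W^P, and its dual in the dual basis
   f_w.  Both are functions on W^P. *)
Definition QWP : Type := {ffun WP -> Q}.
Definition QWPdual : Type := {ffun WP -> Q}.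

Definition projQ (x : QW) : QWP := [ffun v => \sum_(w | bar w == v) x w].

Definition inDP (z : QWP) : Prop := exists2 x, inD x & z = projQ x.

Definition eval (f : QWPdual) (z : QWP) : Q := \sum_v f v * z v.

Definition inDPdual (f : QWPdual) : Prop := forall z, inDP z -> inS (eval f z).

Definition inSWPdual (f : QWPdual) : Prop := forall v, inS (f v).

Definition dual_basis (q : Q) (v : WP) : QWPdual :=
  [ffun u => if u == v then q else 0].

(* q delta_w (.) p f_v = q w(p) f_{bar (w v)} *)
Definition odot (x : QW) (f : QWPdual) : QWPdual :=
  \sum_w \sum_v dual_basis (x w * qact w (f v)) (bar (w * val v)%g).

(* R[W] acting on R[W/W_P], the free module on W^P; an element x of R[W] is
   \sum_w x w w.  For R = Z this is the induced representation Ind 1. *)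
Definition RWP : Type := {ffun WP -> R}.

Definition permact (x : {ffun W -> R}) (f : RWP) : RWP :=
  \sum_w \sum_v
    [ffun u => if u == bar (w * val v)%g then x w * f v else 0].

Definition RWP_emb (f : RWP) : QWPdual := [ffun v => emb Q (f v)%:MP].

Definition E_Q (phi : QWPdual -> QWPdual) : Prop :=
  endomorphism odot (fun=> True) (fun=> True) phi.

(* Under extension of scalars, an endomorphism of an S-form of Q_{W/W_P}^*
   corresponds to the phi in E_Q that restricts to it. *)
Definition E_D (phi : QWPdual -> QWPdual) : Prop :=
  E_Q phi /\ endomorphism odot inD inDPdual phi.

Definition E_S (phi : QWPdual -> QWPdual) : Prop :=
  E_Q phi /\ endomorphism odot inSW inSWPdual phi.

Definition E_RW (phi : QWPdual -> QWPdual) : Prop :=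
  E_Q phi /\ exists psi : RWP -> RWP,
    endomorphism permact (fun=> True) (fun=> True) psi
    /\ forall f, phi (RWP_emb f) = RWP_emb (psi f).

(* Schubert classes; bar 1 is the neutral element of W. *)
Definition pt_class : QWPdual :=
  dual_basis (\prod_(i in neg_roots B :\: levi_roots J) emb Q (xroot R i))
             (bar 1%g).

Definition schubert (t : seq 'I_(b_size B)) : QWPdual :=
  odot (\big[mulQW/delta 1 1%g]_(j <- t) demazure (simple j)) pt_class.

(* rw w is a chosen reduced expression of w *)
Definition E_D0 (rw : WP -> seq 'I_(b_size B)) (phi : QWPdual -> QWPdual) :
    Prop :=
  E_D phi /\ exists a : WP -> WP -> S,
    (forall w, phi (schubert (rw w)) =
       \sum_v [ffun u => emb Q (a v w) * schubert (rw v) u])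
    /\ (forall v w,
         ((len B (val w) <= len B (val v))%N ->
            a v w \is (len B (val v) - len B (val w))%N.-homog)
         /\ ((len B (val v) < len B (val w))%N -> a v w = 0)).

End Demazure.

(* Main.v *)
Require Import Defs.
From HB Require Import structures.
From mathcomp Require Import all_boot all_order all_algebra all_fingroup.
From mathcomp Require Import mpoly.
From mathcomp Require Import ring zify.

(** Write f_1 for the dual basis vector at the coset of 1.  An endomorphism phi
    of the Q_W-module Q_{W/W_P}^* is determined by phi(f_1), because f_v is
    delta_v (.) f_1.  It lies in E_S iff the coordinates of phi(f_1) are in S,
    and in End_{R[W]}(R[W/W_P]) iff they are in R (E_S_of, E_RW_of).

    If phi is in E_S and in E_D^(0), then phi([pt]) is a combination of the
    Schubert classes xi_v with coefficients homogeneous of degree l(v).  The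
    coordinates of xi_v are homogeneous of degree N - l(v), with N = dim G/P,
    hence those of phi([pt]) = e phi(f_1) have degree N, where e is a product of
    N roots.  Since roots are regular in S when 2 is regular in R
    (xroot_regular), the coordinates of phi(f_1) have degree 0: they are
    constants (E_D0_sub_E_RW).

    For the converse, D_P^* turns out to be the set of the f such that all
    coordinates of x (.) f are in S for all x in D (inDPdualP); so E_S is
    contained in E_D (E_S_sub_E_D).  It remains to expand phi(xi_w) in Schubert
    classes, with coefficients in S of the right degree, when phi is defined over
    R; this is possible for every element of D_P^* (schubert_expand), by
    descending along lengths.  For the division that this requires, let f be in
    D_P^* with support in length at most l(v).  With w the longest element of
    W^P, a word for w v^-1 gives an element of D that moves the coordinate of f
    at v to w, with a factor that turns the leading coordinate of xi_v into +-1
    (lead_divisible).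

    Both directions use that [pt] itself is in D_P^* (int_orbit_pt).  That is the
    statement that, for every product x of Demazure elements, the sum of the
    coefficients of x over W_P has denominator dividing e.  This is an identity
    between polynomials in the simple roots with integral coefficients.  It can
    thus be proved in the polynomial ring over the simple roots, where distinct
    positive roots generate distinct prime ideals, one root at a time: the
    coefficients have at most a simple pole along a root b, with opposite
    residues at u and s_b u (residue_step, numer_levi_sum).

    Finally, a decomposition of R[W/W_P] gives an idempotent in
    End_{R[W]}(R[W/W_P]), which preserves D_P^* and thus decomposes it; both
    decompositions are visible on f_1, of which [pt] is the multiple by the unit
    e of Q (summand_trivial). *)

Set Implicit Arguments.
Unset Strict Implicit.
Unset Printing Implicit Defensive.

Import GRing.Theory Num.Theory Order.Theory.
Local Open Scope ring_scope.

(* Polynomial roots and coordinates in a basis have the same names. *)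
Local Notation root := Defs.root.
Local Notation coord := Defs.coord.

(** * The action of the Weyl group on the roots *)

Section RootAction.

Variables (Phi : root_datum) (B : base Phi) (W : weyl_group Phi).
Local Notation refl := (weyl_refl W).
Local Notation al := (@simple _ B).

Definition pairing (i : rd_ix Phi) (x : 'cV[int]_(rd_rank Phi)) : int :=
  (coroot i *m x) 0 0.

Lemma refl_mxE (i : rd_ix Phi) (x : 'cV[int]_(rd_rank Phi)) :
  refl_mx (root i) (coroot i) *m x = x - root i *~ pairing i x.
Proof.
rewrite /refl_mx mulmxBl mul1mx -mulmxA; congr (_ - _).
rewrite [coroot i *m x]mx11_scalar mul_mx_scalar -/(pairing i x).
by rewrite -[in RHS]scaler_int intz.
Qed.

Lemma refl_mxK (i : rd_ix Phi) :
  refl_mx (root i) (coroot i) *m refl_mx (root i) (coroot i) = 1%:M.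
Proof.
rewrite [X in X *m _]/refl_mx mulmxBl mul1mx {1}/refl_mx /refl_mx.
rewrite mulmxBr mulmx1 -mulmxA [coroot i *m (_ *m _)]mulmxA.
rewrite [coroot i *m root i]mx11_scalar root_coroot mul_scalar_mx -scalemxAr.
rewrite scaler_nat mulr2n.
by rewrite opprB addrK subrK.
Qed.

Lemma weyl_reflK i : (refl i * refl i = 1)%g.
Proof.
by apply: weyl_mx_inj; rewrite weyl_mxM weyl_mx1 !weyl_reflE refl_mxK.
Qed.

Lemma weyl_reflV i : ((refl i)^-1 = refl i)%g.
Proof. by apply/eqP; rewrite eq_invg_mul weyl_reflK. Qed.

(** The transport of a root includes that of its reflection, hence of its coroot:
    both are needed for w to act on the root datum. *)
Definition root_stable : {set W} :=
  [set w : W | [forall i, [exists k,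
     (root k == weyl_mx w *m root i) && (refl k == (w * refl i * w^-1)%g)]]].

Lemma root_stableP (w : W) :
  reflect (forall i, exists k, root k = weyl_mx w *m root i
                       /\ refl k = (w * refl i * w^-1)%g)
          (w \in root_stable).
Proof.
rewrite inE; apply: (iffP forallP) => H i.
  by have /existsP [k /andP [/eqP h1 /eqP h2]] := H i; exists k.
by apply/existsP; have [k [h1 h2]] := H i; exists k; rewrite h1 h2 !eqxx.
Qed.

Lemma root_stable_group_set : group_set root_stable.
Proof.
apply/group_setP; split.
  apply/root_stableP => i; exists i.
  by rewrite weyl_mx1 mul1mx mul1g invg1 mulg1.
move=> x y /root_stableP Hx /root_stableP Hy; apply/root_stableP => i.
have [k [k1 k2]] := Hy i; have [l [l1 l2]] := Hx k.
exists l; rewrite l1 l2 k1 k2 weyl_mxM mulmxA; split=> //.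
by rewrite invMg !mulgA.
Qed.

Lemma root_stableT w : w \in root_stable.
Proof.
pose G := group root_stable_group_set.
suff : [set: W] \subset G by move=> /subsetP; apply; rewrite inE.
rewrite -weyl_gen gen_subG; apply/subsetP => _ /imsetP [i _ ->].
apply/root_stableP => j; have [k [k1 k2]] := root_refl i j.
exists k; rewrite weyl_reflE; split=> //.
apply: weyl_mx_inj; rewrite !weyl_mxM weyl_reflV !weyl_reflE.
rewrite {1}/refl_mx k1 k2 -{1}(refl_mxK i).
move: (refl_mx (root i) (coroot i)) => s.
by rewrite [refl_mx (root j) _]/refl_mx mulmxBr mulmx1 mulmxBl !mulmxA.
Qed.

(** The default value is never reached; see root_wact. *)
Definition wact (w : W) (i : rd_ix Phi) : rd_ix Phi :=
  odflt i [pick k | root k == weyl_mx w *m root i].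

Lemma root_wact w i : root (wact w i) = weyl_mx w *m root i.
Proof.
rewrite /wact; case: pickP => [k /eqP //|H].
have [k [k1 _]] := root_stableP w (root_stableT w) i.
by have := H k; rewrite k1 eqxx.
Qed.

Lemma wact1 i : wact 1%g i = i.
Proof. by apply: root_inj; rewrite root_wact weyl_mx1 mul1mx. Qed.

Lemma wactM u v i : wact (u * v)%g i = wact u (wact v i).
Proof. by apply: root_inj; rewrite !root_wact weyl_mxM mulmxA. Qed.

Lemma wactK u : cancel (wact u) (wact u^-1%g).
Proof. by move=> i; rewrite -wactM mulVg wact1. Qed.

Lemma wactVK u : cancel (wact u^-1%g) (wact u).
Proof. by move=> i; rewrite -wactM mulgV wact1. Qed.

Lemma wact_inj u : injective (wact u).
Proof. exact: can_inj (wactK u). Qed.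

Lemma refl_wact w i : refl (wact w i) = (w * refl i * w^-1)%g.
Proof.
have [k [k1 k2]] := root_stableP w (root_stableT w) i.
by rewrite -k2; congr refl; apply: root_inj; rewrite root_wact.
Qed.

Lemma root_refl_wact i j :
  root (wact (refl i) j) = root j - root i *~ pairing i (root j).
Proof. by rewrite root_wact weyl_reflE refl_mxE. Qed.

Definition ropp (i : rd_ix Phi) : rd_ix Phi := wact (refl i) i.

Lemma root_opp i : root (ropp i) = - root i.
Proof.
rewrite root_refl_wact /pairing root_coroot.
have -> : root i *~ 2 = root i + root i by rewrite natz -pmulrn mulr2n.
by rewrite opprD addrA subrr sub0r.
Qed.

Lemma roppK : involutive ropp.
Proof. by move=> i; apply: root_inj; rewrite !root_opp opprK. Qed.

Lemma wact_opp w i : wact w (ropp i) = ropp (wact w i).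
Proof. by apply: root_inj; rewrite root_wact !root_opp mulmxN root_wact. Qed.

Lemma refl_opp i : refl (ropp i) = refl i.
Proof. by rewrite refl_wact mulgK. Qed.

Lemma root_neq0 i : root i != 0 :> 'cV_(rd_rank Phi).
Proof.
apply/eqP => h; have := root_coroot i; rewrite h mulmx0 mxE.
by move=> /eqP; rewrite eq_sym.
Qed.

(** * Positive and negative roots *)

Lemma coord_uniq i c :
  root i = \sum_j root (al j) *~ c j -> forall j, coord B i j = c j.
Proof.
move=> h j; apply/eqP; rewrite -subr_eq0; apply/eqP.
apply: (@simple_free _ B (fun j => coord B i j - c j)) => {j}.
under eq_bigr do rewrite mulrzBr.
by rewrite sumrB -coord_root -h subrr.
Qed.

Lemma coord_simple j l : coord B (al j) l = (j == l)%:R.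
Proof.
apply: (@coord_uniq _ (fun l => (j == l)%:R)).
rewrite (bigD1 j) //= eqxx mulr1z big1 ?addr0 // => k kj.
by rewrite eq_sym (negPf kj) mulr0z.
Qed.

Lemma coord_sub i j k z :
  root k = root i - root j *~ z ->
  forall l, coord B k l = coord B i l - coord B j l * z.
Proof.
move=> h; apply: coord_uniq; rewrite h (coord_root B i) (coord_root B j).
rewrite mulrz_suml -sumrB; apply: eq_bigr => l _.
by rewrite mulrzBr mulrzA.
Qed.

Lemma coord_opp i l : coord B (ropp i) l = - coord B i l.
Proof.
rewrite (coord_sub (root_refl_wact i i)) /pairing root_coroot; lia.
Qed.

Definition rneg i := i \in neg_roots B.

Lemma rnegP i : reflect (forall j, coord B i j <= 0) (rneg i).
Proof. by rewrite /rneg inE; apply: forallP. Qed.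

Lemma coord_neq0 i : exists j, coord B i j != 0.
Proof.
apply/existsP; apply: contraT; rewrite negb_exists => /forallP h.
have := root_neq0 i; rewrite (coord_root B i) big1 ?eqxx // => j _.
by have := h j; rewrite negbK => /eqP ->; rewrite mulr0z.
Qed.

Lemma rposP i : reflect (forall j, 0 <= coord B i j) (~~ rneg i).
Proof.
apply: (iffP idP) => [h|h].
  by have [//|/rnegP h'] := coord_sign B i; rewrite h' in h.
apply/rnegP => h'; have [j] := coord_neq0 i.
by rewrite eq_le h h'.
Qed.

(** The coordinates of a root have a common sign, so a single nonzero one
    determines it. *)
Lemma rpos_coord i j : 0 < coord B i j -> ~~ rneg i.
Proof. by move=> h; apply/rnegP => /(_ j); rewrite leNgt h. Qed.

Lemma rneg_opp i : rneg (ropp i) = ~~ rneg i.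
Proof.
apply/rnegP/rposP => h j; first by have := h j; rewrite coord_opp oppr_le0.
by rewrite coord_opp oppr_le0.
Qed.

Lemma rneg_simple j : rneg (al j) = false.
Proof. by apply/negbTE/rposP => l; rewrite coord_simple ler0n. Qed.

Local Notation s_ j := (refl (al j)).

Lemma coord_refl_simple j i l : l != j ->
  coord B (wact (s_ j) i) l = coord B i l.
Proof.
move=> lj; rewrite (coord_sub (root_refl_wact (al j) i)).
by rewrite coord_simple eq_sym (negPf lj) mul0r subr0.
Qed.

Lemma root_prop i k (z : int) : root i = root k *~ z -> i = k \/ i = ropp k.
Proof.
move=> h; case: (eqVneq z 0) => [z0|z0].
  by move: (root_neq0 i); rewrite h z0 mulr0z eqxx.
have h1 : root i *~ 1 = root k *~ z by rewrite h mulr1z.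
have [h'|h'] := root_reduced (oner_neq0 _) z0 h1; first by left; apply: root_inj.
by right; apply: root_inj; rewrite root_opp.
Qed.

(** Such a root i is not proportional to the simple root j, so it has a nonzero
    coordinate outside j, and s_j leaves that coordinate unchanged. *)
Lemma rneg_refl_simple j i :
  i != al j -> i != ropp (al j) ->
  rneg (wact (s_ j) i) = rneg i.
Proof.
move=> n1 n2.
have [l lj cl] : exists2 l, l != j & coord B i l != 0.
  apply/exists_inP; apply: contraT; rewrite negb_exists_in => /forall_inP h.
  have : root i = root (al j) *~ coord B i j.
    rewrite (coord_root B i) (bigD1 j) //= big1 ?addr0 // => l lj.
    by have := h l lj; rewrite negbK => /eqP ->; rewrite mulr0z.
  by case/root_prop => h'; rewrite h' eqxx in n1 n2.
have e := coord_refl_simple i lj.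
have [ineg|ipos] := boolP (rneg i).
  have cl0 : coord B i l < 0 by rewrite lt_neqAle cl; apply/rnegP.
  by apply: contraT => /rposP /(_ l); rewrite e leNgt cl0.
have cl0 : 0 < coord B i l by rewrite lt_neqAle eq_sym cl; apply/rposP.
by apply/negbTE/(@rpos_coord _ l); rewrite e.
Qed.

(** * Words, inversions and lengths *)

Local Notation wd := (word_elt (B := B) W).

Lemma word_nil : wd [::] = 1%g. Proof. by rewrite /word_elt big_nil. Qed.

Lemma word_cons j t : wd (j :: t) = (s_ j * wd t)%g.
Proof. by rewrite /word_elt big_cons. Qed.

Lemma word_cat t u : wd (t ++ u) = (wd t * wd u)%g.
Proof. by rewrite /word_elt big_cat. Qed.

Lemma word_rcons t j : wd (rcons t j) = (wd t * s_ j)%g.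
Proof. by rewrite -cats1 word_cat word_cons word_nil mulg1. Qed.

(** Along the letters of t, read from the right, the image of the simple root j
    changes sign at some letter i.  There it equals the simple root i, so that
    the letter i is conjugate to s_j and cancels against it. *)
Lemma exchange t j : rneg (wact (wd t) (al j)) ->
  exists2 t', (size t').+1 = size t & wd t' = (wd t * s_ j)%g.
Proof.
elim: t => [|i t IH]; first by rewrite word_nil wact1 rneg_simple.
rewrite word_cons wactM; have [h _|h] := boolP (rneg (wact (wd t) (al j))).
  have [t' st' et'] := IH h; exists (i :: t'); first by rewrite /= st'.
  by rewrite word_cons et' mulgA.
case: (eqVneq (wact (wd t) (al j)) (al i)) => [e _|n1].
  exists t => //; have := refl_wact (wd t) (al j).
  by rewrite e => ->; rewrite mulgKV -mulgA weyl_reflK mulg1.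
case: (eqVneq (wact (wd t) (al j)) (ropp (al i))) => [e|n2].
  by rewrite e rneg_opp rneg_simple in h.
by rewrite rneg_refl_simple // (negPf h).
Qed.

Definition ninv (w : W) : nat := #|[set i | ~~ rneg i & rneg (wact w i)]|.

Lemma ninv_simple w j : ~~ rneg (wact w (al j)) ->
  ninv (w * s_ j)%g = (ninv w).+1.
Proof.
move=> h; rewrite /ninv.
set A := [set i | ~~ rneg i & rneg (wact w i)].
have jA : al j \notin wact (s_ j) @^-1: A.
  by rewrite !inE -/(ropp (al j)) rneg_opp rneg_simple.
have -> : [set i | ~~ rneg i & rneg (wact (w * s_ j)%g i)] =
          al j |: (wact (s_ j) @^-1: A).
  apply/setP => i; rewrite !inE wactM.
  case: (eqVneq i (al j)) => [->|n1] /=.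
    by rewrite rneg_simple -/(ropp _) wact_opp rneg_opp h.
  case: (eqVneq i (ropp (al j))) => [->|n2].
    rewrite rneg_opp rneg_simple wact_opp -/(ropp _) roppK.
    by rewrite (negPf h) !andbF.
  by rewrite rneg_refl_simple.
by rewrite cardsU1 jA card_preimset //; apply: wact_inj.
Qed.

Lemma ninv_le w : (ninv w <= #|rd_ix Phi|)%N. Proof. exact: max_card. Qed.

Lemma ninv1 : ninv 1%g = 0%N.
Proof.
apply/eqP; rewrite cards_eq0; apply/eqP/setP => i; rewrite !inE wact1.
by case: rneg.
Qed.

Lemma wact_coord w i : root (wact w i) =
  \sum_j root (wact w (al j)) *~ coord B i j.
Proof.
rewrite root_wact {1}(coord_root B i) mulmx_sumr; apply: eq_bigr => j _.
by rewrite root_wact -!scaler_int -scalemxAr.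
Qed.

Lemma coord_wact w i l : coord B (wact w i) l =
  \sum_j coord B (wact w (al j)) l * coord B i j.
Proof.
move: l; apply: coord_uniq; rewrite wact_coord.
under eq_bigr => j _ do rewrite (coord_root B (wact w _)) mulrz_suml.
rewrite exchange_big /=; apply: eq_bigr => l _.
rewrite mulrz_sumr; apply: eq_bigr => j _; by rewrite mulrzA.
Qed.

(** The image is a combination, with nonnegative coefficients, of images of simple
    roots in the support of i. *)
Lemma wact_pos w i : ~~ rneg i ->
  (forall j, coord B i j != 0 -> ~~ rneg (wact w (al j))) ->
  ~~ rneg (wact w i).
Proof.
move=> /rposP ipos h; apply/rposP => l; rewrite coord_wact.
apply: sumr_ge0 => j _; case: (eqVneq (coord B i j) 0) => [->|n0].
  by rewrite mulr0.
by apply: mulr_ge0 => //; apply/rposP/h.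
Qed.

(** An element with as many inversions as possible makes every simple root
    negative, since otherwise one more letter would add an inversion. *)
Lemma longest_word : exists t, forall i, rneg (wact (wd t) i) = ~~ rneg i.
Proof.
have [t tj] : exists t, forall j, rneg (wact (wd t) (al j)).
  have [m] := ubnP (#|rd_ix Phi| - ninv (wd [::])); elim: m [::] => // m IH t.
  rewrite ltnS => h.
  have [/forallP tj|/forallPn [j tj]] :=
    boolP [forall j, rneg (wact (wd t) (al j))]; first by exists t.
  apply: (IH (rcons t j)); rewrite word_rcons ninv_simple //.
  apply: leq_trans h; apply: ltn_sub2l; rewrite // -(ninv_simple tj).
  exact: ninv_le.
have neg i : ~~ rneg i -> rneg (wact (wd t) i).
  move=> ipos; rewrite -[X in rneg X]roppK rneg_opp -wact_opp.
  apply/rposP => l; rewrite coord_wact sumr_ge0 // => j _.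
  rewrite coord_opp mulrN -mulNr -coord_opp.
  apply: mulr_ge0; first by apply/rposP; rewrite rneg_opp tj.
  by apply/rposP.
exists t => i; have [ineg|/neg //] := boolP (rneg i).
apply/negbTE; rewrite -[i]roppK wact_opp rneg_opp negbK.
by apply: neg; rewrite rneg_opp ineg.
Qed.

(** Along the letters of a word that makes a positive root negative, the sign can
    only change when the image is simple. *)
Lemma root_conj_simple i : exists t j, i = wact (wd t) (al j).
Proof.
wlog ipos : i / ~~ rneg i => [IH|].
  have [ineg|/IH //] := boolP (rneg i).
  have [t [j e]] : exists t j, ropp i = wact (wd t) (al j).
    by apply: IH; rewrite rneg_opp ineg.
  exists (rcons t j), j; rewrite word_rcons wactM -/(ropp _) wact_opp -e.
  by rewrite roppK.
have [t /(_ i)] := longest_word; rewrite ipos => h.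
have {h} : exists2 k, ~~ rneg (wact (wd (rev k)) i) & exists j,
     rneg (wact (wd (rev (rcons k j))) i).
  rewrite -[t]revK in h; elim/last_ind: (rev t) h => [|k j IH h].
    by rewrite word_nil wact1 (negPf ipos).
  have [hk|hk] := boolP (rneg (wact (wd (rev k)) i)); first exact: IH.
  by exists k => //; exists j.
case=> k kpos [j]; rewrite rev_rcons word_cons wactM.
case: (eqVneq (wact (wd (rev k)) i) (al j)) => [e _|n1].
  exists k, j; rewrite -e -wactM.
  suff -> : (wd k * wd (rev k) = 1)%g by rewrite wact1.
  elim: (k) => [|l k' IH]; first by rewrite word_nil mulg1.
  rewrite rev_cons word_rcons word_cons !mulgA -(mulgA (s_ l)) IH mulg1.
  exact: weyl_reflK.
case: (eqVneq (wact (wd (rev k)) i) (ropp (al j))) => [e|n2].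
  by rewrite e rneg_opp rneg_simple in kpos.
by rewrite rneg_refl_simple // (negPf kpos).
Qed.

Lemma word_inv t : ((wd t)^-1 = wd (rev t))%g.
Proof.
elim: t => [|j t IH]; first by rewrite word_nil invg1.
by rewrite word_cons invMg IH rev_cons word_rcons weyl_reflV.
Qed.

Lemma word_exists w : exists t, wd t = w.
Proof.
have : w \in <<[set refl i | i : rd_ix Phi]>>%g by rewrite weyl_gen inE.
case/gen_prodgP => n [c cP ->].
elim: n c cP => [|n IH] c cP; first by exists [::]; rewrite big_ord0 word_nil.
rewrite big_ord_recl.
have [t <-] := IH (fun k => c (lift ord0 k)) (fun k => cP _).
have /imsetP [i _ ->] := cP ord0.
have [u [j ->]] := root_conj_simple i; rewrite refl_wact word_inv.
by exists (u ++ j :: rev u ++ t); rewrite !(word_cat, word_cons) !mulgA.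
Qed.

Local Notation len := (len B).

(** Words of length at least #|W| are not compared by len, but then len is at most
    #|W| by construction. *)
Lemma len_word t : (len (wd t) <= size t)%N.
Proof.
rewrite /Defs.len; have [tW|Wt] := ltnP (size t) #|W|; last first.
  by apply: leq_trans Wt; rewrite -[X in (_ <= X)%N](size_iota 0) find_size.
rewrite leqNgt; apply/negP => /(before_find 0%N) /=.
by rewrite nth_iota // add0n => /existsP []; exists (in_tuple t); apply/eqP.
Qed.

Lemma len_reduced w : exists2 t, wd t = w & size t = len w.
Proof.
have [t0 e0] := word_exists w.
pose e : rel W := fun x y => [exists j, y == (x * s_ j)%g].
(* A path in the Cayley graph can be shortened to one without repeated vertices,
   and that has fewer than #|W| steps. *)
have [p [ep pw up]] : exists p, [/\ path e 1%g p, w = last 1%g p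
                    & (size p < #|W|)%N].
  have : exists2 p, path e 1%g p & w = last 1%g p.
    elim/last_ind: t0 w e0 => [|t j IH] w <-.
      by exists [::]; rewrite // word_nil.
    have [p ep ew] := IH _ erefl.
    exists (rcons p (wd t * s_ j)%g); last by rewrite last_rcons word_rcons.
    by rewrite rcons_path ep -ew; apply/existsP; exists j.
  case=> p ep ->; case/shortenP: ep => p' ep' up' _.
  by exists p'; split=> //; move/card_uniqP: up' => /= <-; apply: max_card.
have [t te st] : exists2 t, wd t = w & size t = size p.
  rewrite pw {pw up e0}; elim/last_ind: p ep => [|p x IH].
    by exists [::]; rewrite ?word_nil.
  rewrite rcons_path => /andP [/IH [t te st] /existsP [j /eqP h]].
  by exists (rcons t j); rewrite ?size_rcons ?st // word_rcons te last_rcons h.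
have hl : (len w < #|W|)%N.
  by rewrite -te; apply: leq_ltn_trans (len_word t) _; rewrite st.
have : has (fun k => [exists t : k.-tuple 'I_(b_size B), word_elt W t == w])
       (iota 0 #|W|) by rewrite has_find size_iota.
move/(nth_find 0%N); rewrite nth_iota // add0n => /existsP [u /eqP h].
by exists u; rewrite // size_tuple.
Qed.

Lemma len1 : len (1%g : W) = 0%N.
Proof. by apply/eqP; rewrite -leqn0 -word_nil len_word. Qed.

Lemma len_mul (u v : W) : (len (u * v)%g <= len u + len v)%N.
Proof.
have [t <- <-] := len_reduced u; have [t' <- <-] := len_reduced v.
by rewrite -word_cat -size_cat len_word.
Qed.

Lemma len_inv (u : W) : len u^-1%g = len u.
Proof.
have h (v : W) : (len (v^-1)%g <= len v)%N.
  by have [t <- <-] := len_reduced v; rewrite word_inv -(size_rev t) len_word.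
by apply/eqP; rewrite eqn_leq h -{1}(invgK u) h.
Qed.

Lemma len_simple_neg w j : rneg (wact w (al j)) ->
  len w = (len (w * s_ j)%g).+1.
Proof.
move=> h; apply/eqP; rewrite eqn_leq; apply/andP; split.
  rewrite -{1}(mulgK (s_ j) w) weyl_reflV; apply: leq_trans (len_mul _ _) _.
  rewrite -addn1 leq_add2l -[s_ j]mulg1 -word_nil -word_cons.
  exact: len_word.
have [t tw ts] := len_reduced w; rewrite -tw in h.
have [t' st' et'] := exchange h.
by rewrite -ts -st' ltnS -tw -et' len_word.
Qed.

Lemma len_simple_pos w j : ~~ rneg (wact w (al j)) ->
  len (w * s_ j)%g = (len w).+1.
Proof.
move=> h; rewrite (@len_simple_neg _ j) -?mulgA ?weyl_reflK ?mulg1 //.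
by rewrite wactM -/(ropp _) wact_opp rneg_opp h.
Qed.

Lemma len_ninv w : len w = ninv w.
Proof.
have [t <-] := word_exists w.
elim/last_ind: t {w} => [|t j IH]; first by rewrite word_nil len1 ninv1.
rewrite word_rcons; have [h|h] := boolP (rneg (wact (wd t) (al j))).
  apply: succn_inj; rewrite -len_simple_neg // IH.
  rewrite -(@ninv_simple _ j) -?mulgA ?weyl_reflK ?mulg1 //.
  by rewrite wactM -/(ropp _) wact_opp rneg_opp h.
by rewrite len_simple_pos // ninv_simple // IH.
Qed.

(** So the sign pattern of the images of the roots determines an element of W. *)
Lemma ninv_eq0 w : (forall i, ~~ rneg i -> ~~ rneg (wact w i)) -> w = 1%g.
Proof.
move=> h; have [t tw ts] := len_reduced w.
suff /eqP e : len w == 0%N by move: ts; rewrite e -tw => /size0nil ->; rewrite word_nil.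
rewrite len_ninv cards_eq0; apply/eqP/setP => i; rewrite !inE.
by apply/negP => /andP [/h /negPf ->].
Qed.

End RootAction.

(** * Minimal representatives of cosets *)

Section ParabolicReps.

Variables (Phi : root_datum) (B : base Phi) (W : weyl_group Phi).
Variable J : {set 'I_(b_size B)}.
Local Notation refl := (weyl_refl W).
Local Notation al := (@simple _ B).
Local Notation s_ j := (refl (al j)).
Local Notation rneg := (rneg B).
Local Notation len := (len B).
Local Notation WL := (weyl_levi W J).
Local Notation WP := (WP W J).
Local Notation bar := (@bar _ B W J).

Definition levi i := i \in levi_roots J.

Lemma leviP i : reflect (forall j, j \notin J -> coord B i j = 0) (levi i).
Proof.
rewrite /levi inE; apply: (iffP forallP) => h j.
  by move=> jJ; have := h j; rewrite jJ => /eqP.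
by apply/implyP => jJ; apply/eqP/h.
Qed.

Lemma levi_opp i : levi (ropp W i) = levi i.
Proof.
by apply/leviP/leviP => h j /h /eqP e; apply/eqP; move: e;
  rewrite coord_opp oppr_eq0.
Qed.

Lemma coord_refl_levi i k l : levi i -> l \notin J ->
  coord B (wact (refl i) k) l = coord B k l.
Proof.
move=> /leviP h lJ; rewrite (coord_sub (root_refl_wact W i k)).
by rewrite (h l lJ) mul0r subr0.
Qed.

(** Reflections in roots of the Levi subgroup only change coordinates in J. *)
Lemma coord_levi u k l : u \in WL -> l \notin J ->
  coord B (wact u k) l = coord B k l.
Proof.
case/gen_prodgP => n [c cP ->] lJ.
elim: n c cP k => [|n IH] c cP k; first by rewrite big_ord0 wact1.
rewrite big_ord_recl wactM; have /imsetP [i iL ->] := cP ord0.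
by rewrite coord_refl_levi // (IH (fun k => c (lift ord0 k))).
Qed.

Lemma levi_wact u k : u \in WL -> levi (wact u k) = levi k.
Proof. by move=> uW; apply/leviP/leviP => h j jJ; move: (h j jJ); rewrite coord_levi. Qed.

(** The sign of k can be read on a coordinate outside J. *)
Lemma rneg_wact_levi u k : u \in WL -> ~~ levi k -> rneg (wact u k) = rneg k.
Proof.
move=> uW kL.
have [l lJ cl] : exists2 l, l \notin J & coord B k l != 0.
  apply/exists_inP; apply: contraNT kL; rewrite negb_exists_in => /forall_inP h.
  by apply/leviP => j /h; rewrite negbK => /eqP.
have e := coord_levi k uW lJ.
have [kneg|kpos] := boolP (rneg k).
  have cl0 : coord B k l < 0 by rewrite lt_neqAle cl; apply/rnegP.
  by apply: contraT => /rposP /(_ l); rewrite e leNgt cl0.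
have cl0 : 0 < coord B k l by rewrite lt_neqAle eq_sym cl; apply/rposP.
by apply/negbTE/(@rpos_coord _ B _ l); rewrite e.
Qed.

Lemma min_repP (w : W) : reflect (forall u, u \in WL -> (len w <= len (w * u)%g)%N)
  (min_rep J w).
Proof. exact: forall_inP. Qed.

(** By minimality of w it suffices to consider the simple roots in J: if w made one
    negative, w s_j would be shorter. *)
Lemma min_rep_pos (w : W) i : min_rep J w -> levi i -> ~~ rneg i ->
  ~~ rneg (wact w i).
Proof.
move=> /min_repP h /leviP iL ipos; apply: wact_pos => // j cj.
apply/negP => /len_simple_neg e.
have : s_ j \in WL.
  apply/mem_gen/imset_f; apply/leviP => k kJ; rewrite coord_simple.
  by case: eqP => // jk; rewrite jk iL // in cj.
by move/h; rewrite e ltnn.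
Qed.

Lemma min_rep_neg (w : W) i : min_rep J w -> levi i -> rneg (wact w i) = rneg i.
Proof.
move=> wP iL; have [ineg|ipos] := boolP (rneg i); last first.
  exact/negbTE/min_rep_pos.
rewrite -[i](roppK W) wact_opp (rneg_opp _ W) min_rep_pos ?levi_opp //.
by rewrite (rneg_opp _ W) ineg.
Qed.

Lemma min_rep_uniq (w u : W) : min_rep J w -> min_rep J (w * u)%g -> u \in WL ->
  u = 1%g.
Proof.
move=> wP wuP uL; apply: (ninv_eq0 (B := B)) => i.
have [iL|iL] := boolP (levi i); last by rewrite rneg_wact_levi.
move=> ipos; have := min_rep_pos wuP iL ipos.
by rewrite wactM min_rep_neg ?levi_wact.
Qed.

Lemma bar_coset w : exists2 u, u \in WL & val (bar w) = (w * u)%g.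
Proof.
rewrite /= /bar_val; case: arg_minnP => [|v vw minv]; first exact: lcoset_refl.
by case/lcosetP: vw => u uL ->; exists u.
Qed.

Lemma barK v : bar (val v) = v.
Proof.
apply: val_inj; have [u uL e] := bar_coset (val v).
have := valP (bar (val v)); rewrite e => h.
by rewrite (min_rep_uniq (valP v) h uL) mulg1.
Qed.

Lemma bar_mulr w u : u \in WL -> bar (w * u)%g = bar w.
Proof.
move=> uL; apply: val_inj; have [u1 u1L e1] := bar_coset (w * u)%g.
have [u2 u2L e2] := bar_coset w.
have e : val (bar (w * u)%g) = (val (bar w) * (u2^-1 * u * u1))%g.
  by rewrite e1 e2 !mulgA mulgK.
have h := valP (bar (w * u)%g); rewrite e in h.
by rewrite e (min_rep_uniq (valP (bar w)) h) ?mulg1 // !groupM ?groupV.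
Qed.

Lemma bar_eq w w' : (bar w == bar w') = ((w^-1 * w')%g \in WL).
Proof.
apply/eqP/idP => [e|h]; last by rewrite -(bar_mulr w h) mulKVg.
have [u1 u1L e1] := bar_coset w; have [u2 u2L e2] := bar_coset w'.
have : (w * u1 = w' * u2)%g by rewrite -e1 -e2 e.
move/(canRL (mulgK _)) => ->; rewrite invMg invgK -mulgA.
by rewrite invMg -!mulgA mulVg mulg1 groupM ?groupV.
Qed.

Lemma bar_mull (x w : W) : bar (x * val (bar w))%g = bar (x * w)%g.
Proof. by have [u uL ->] := bar_coset w; rewrite mulgA bar_mulr. Qed.

Lemma val_bar1 : val (bar 1%g) = 1%g.
Proof.
have h : min_rep J (1%g : W) by apply/min_repP => u _; rewrite len1.
by have := congr1 val (barK (exist _ 1%g h)).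
Qed.

Lemma len_bar_le w : (len (val (bar w)) <= len w)%N.
Proof.
have [u uL e] := bar_coset w.
have /min_repP /(_ u^-1%g) := valP (bar w).
by rewrite groupV uL e mulgK; apply.
Qed.

Lemma len_bar_mul x w :
  (len (val (bar w)) <= len x + len (val (bar (x * w)%g)))%N.
Proof.
have -> : bar w = bar (x^-1 * val (bar (x * w)))%g by rewrite bar_mull mulKg.
by apply: leq_trans (len_bar_le _) _; rewrite -(len_inv B x) len_mul.
Qed.

(** The minimal representative of the coset of the longest element of W *)
Lemma longest_rep : exists w : WP, forall i,
  rneg (wact (val w) i) = (if levi i then rneg i else ~~ rneg i).
Proof.
have [t h] := longest_word B W; set w0 := word_elt W t in h.
exists (bar w0) => i; have [u uL e] := bar_coset w0.
case: ifP => [iL|/negbT iL]; first by rewrite min_rep_neg // (valP (bar w0)).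
by rewrite e wactM h rneg_wact_levi.
Qed.

(** A positive root i with val v i negative is outside the Levi subgroup, and all
    those roots are inversions of w; the others correspond to the inversions of
    w v^-1. *)
Lemma len_longest (w v : WP) :
  (forall i, rneg (wact (val w) i) = (if levi i then rneg i else ~~ rneg i)) ->
  (len (val w * (val v)^-1)%g + len (val v) = len (val w))%N.
Proof.
move=> h; rewrite !(len_ninv B) /ninv.
rewrite -(card_preimset _ (@wact_inj _ W (val v))).
rewrite -[RHS](cardsID [set i | rneg (wact (val v) i)]) addnC.
congr (_ + _)%N; apply: eq_card => i; rewrite !inE.
- rewrite h; case: ifP => [iL|_]; last by case: (rneg i).
  by rewrite (min_rep_neg (valP v) iL); case: (rneg i).
rewrite -wactM mulgKV h; case: ifP => [iL|_]; last by rewrite andbb.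
by rewrite (min_rep_neg (valP v) iL); case: (rneg i).
Qed.

Lemma reduced_cons j t : size (j :: t) = len (word_elt W (j :: t)) ->
  size t = len (word_elt W t) /\ rneg (wact (word_elt W t)^-1%g (al j)) = false.
Proof.
rewrite word_cons /= => h.
have st : size t = len (word_elt W t).
  apply/eqP; rewrite eqn_leq len_word andbT -ltnS h.
  apply: leq_trans (len_mul _ _ _) _; rewrite -add1n leq_add2r.
  by rewrite -[s_ j]mulg1 -(word_nil B) -word_cons; apply: len_word.
split=> //; apply/negP => /len_simple_neg.
rewrite -[s_ j]weyl_reflV -invMg !len_inv -h -st; lia.
Qed.

End ParabolicReps.

(** * Divisibility and substitution in polynomial rings *)

Section Divides.

Variable T : comNzRingType.
Implicit Types a b x y : T.

Definition divides a x := exists q, x = q * a.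

Lemma divides_refl a : divides a a.
Proof. by exists 1; rewrite mul1r. Qed.

Lemma divides0 a : divides a 0.
Proof. by exists 0; rewrite mul0r. Qed.

Lemma dividesD a x y : divides a x -> divides a y -> divides a (x + y).
Proof. by case=> q -> [r ->]; exists (q + r); rewrite mulrDl. Qed.

Lemma dividesMl a x y : divides a x -> divides a (y * x).
Proof. by case=> q ->; exists (y * q); rewrite mulrA. Qed.

Lemma dividesMr a x y : divides a x -> divides a (x * y).
Proof. by rewrite mulrC; apply: dividesMl. Qed.

Lemma dividesN a x : divides a x -> divides a (- x).
Proof. by rewrite -mulN1r; apply: dividesMl. Qed.

Lemma dividesB a x y : divides a x -> divides a y -> divides a (x - y).
Proof. by move=> hx hy; apply/dividesD/dividesN. Qed.

Lemma divides_sum a (I : Type) (r : seq I) (P : pred I) (F : I -> T) :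
  (forall i, P i -> divides a (F i)) -> divides a (\sum_(i <- r | P i) F i).
Proof. by move=> h; apply: big_ind => //; [apply: divides0 | apply: dividesD]. Qed.

Lemma divides_mul a b x y : divides a x -> divides b y -> divides (a * b) (x * y).
Proof. by case=> q -> [r ->]; exists (q * r); rewrite mulrACA. Qed.

End Divides.

Section Substitution.

Variables (R : comNzRingType) (n k : nat).
Implicit Types s t : n.-tuple {mpoly R[k]}.

(** Congruence modulo a is compatible with sums and products. *)
Lemma comp_mpoly_congr s t a : (forall i, divides a (tnth s i - tnth t i)) ->
  forall p : {mpoly R[n]}, divides a ((p \mPo s) - (p \mPo t)).
Proof.
move=> h p; rewrite !comp_mpolyEX -sumrB; apply: divides_sum => m _.
rewrite -scalerBr -mul_mpolyC; apply: dividesMl; rewrite !comp_mpolyX.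
apply: (big_ind2 (fun x y => divides a (x - y))) => [|x1 x2 y1 y2 hx hy|i _].
- by rewrite subrr; apply: divides0.
- have -> : x1 * y1 - x2 * y2 = (x1 - x2) * y1 + x2 * (y1 - y2) by ring.
  by apply: dividesD; [apply: dividesMr | apply: dividesMl].
by rewrite subrXX; apply: dividesMr.
Qed.

Lemma comp_mpolyA l (s : n.-tuple {mpoly R[k]}) (t : k.-tuple {mpoly R[l]}) p :
  (p \mPo s) \mPo t = p \mPo [tuple tnth s i \mPo t | i < n].
Proof.
rewrite (comp_mpolyEX p s) [RHS]comp_mpolyEX raddf_sum /=.
apply: eq_bigr => m _; rewrite comp_mpolyZ !comp_mpolyX rmorph_prod /=.
by congr (_ *: _); apply: eq_bigr => i _; rewrite rmorphXn tnth_mktuple.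
Qed.

End Substitution.

(** * Roots as primes in the symmetric algebra of the root lattice *)

Section RootPrimes.

Variables (Phi : root_datum) (B : base Phi) (W : weyl_group Phi).
Local Notation r := (b_size B).
Local Notation A := {mpoly int[r]}.
Local Notation refl := (weyl_refl W).
Local Notation al := (@simple _ B).
Local Notation rneg := (rneg B).

(** In this ring, unlike in S, the simple roots are variables; this is what makes
    every root prime. *)
Definition yroot (i : rd_ix Phi) : A := \sum_j 'X_j *~ coord B i j.

Lemma yroot_simple j : yroot (al j) = 'X_j.
Proof.
rewrite /yroot (bigD1 j) //= big1 ?addr0 => [|k kj].
  by rewrite coord_simple eqxx mulr1z.
by rewrite coord_simple eq_sym (negPf kj) mulr0z.
Qed.

Lemma mcoeff_yroot i j : (yroot i)@_(U_(j)) = coord B i j.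
Proof.
rewrite /yroot raddf_sum (bigD1 j) //= big1 ?addr0 => [|k kj].
  by rewrite raddfMz /= mcoeffX eqxx mulrzz mul1r.
rewrite raddfMz /= mcoeffX; case: eqP => [e|_]; last by rewrite mul0rz.
by have := congr1 (fun m : 'X_{1..r} => m j) e; rewrite !mnmE eqxx (negPf kj).
Qed.

Lemma yroot_neq0 i : yroot i != 0.
Proof.
have [j cj] := coord_neq0 B i; apply: contraNneq cj => h.
by rewrite -mcoeff_yroot h mcoeff0.
Qed.

Lemma yroot_sub i j k z : root k = root i - root j *~ z ->
  yroot k = yroot i - yroot j *~ z.
Proof.
move=> h; rewrite /yroot mulrz_suml -sumrB; apply: eq_bigr => l _.
by rewrite (coord_sub h) mulrzBr mulrzA.
Qed.

Lemma yroot_opp i : yroot (ropp W i) = - yroot i.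
Proof.
rewrite /yroot -sumrN; apply: eq_bigr => l _.
by rewrite coord_opp mulrNz.
Qed.

Definition ysubst (w : W) : r.-tuple A :=
  [tuple yroot (wact w (al j)) | j < r].

Lemma ysubst_root w i : yroot i \mPo ysubst w = yroot (wact w i).
Proof.
rewrite /yroot raddf_sum /=.
under eq_bigr => j _ do rewrite raddfMz /= comp_mpolyXU -tnth_nth tnth_mktuple.
rewrite /yroot; under eq_bigr => j _ do rewrite mulrz_suml.
rewrite exchange_big /=; apply: eq_bigr => l _.
rewrite coord_wact mulrz_sumr; apply: eq_bigr => j _.
by rewrite mulrzA.
Qed.

Lemma ysubstK w p : (p \mPo ysubst w) \mPo ysubst w^-1%g = p.
Proof.
rewrite comp_mpolyA -[RHS]comp_mpoly_id; congr comp_mpoly.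
apply: eq_from_tnth => j; rewrite !tnth_mktuple.
by rewrite ysubst_root wactK yroot_simple.
Qed.

(** A conjugate of the morphism that sends one variable to 0 *)
Lemma yroot_ker i : exists f : {rmorphism A -> A},
  forall p, f p = 0 <-> divides (yroot i) p.
Proof.
have [t [j ->]] := root_conj_simple B W i; set w := word_elt W t.
pose z : r.-tuple A := [tuple if k == j then 0 else 'X_k | k < r].
pose f : {rmorphism A -> A} := (comp_mpoly z \o comp_mpoly (ysubst w^-1%g))%FUN.
exists f => p; split=> [fp0|[q ->]]; last first.
  rewrite rmorphM /= ysubst_root wactK yroot_simple comp_mpolyXU.
  by rewrite -tnth_nth tnth_mktuple eqxx mulr0.
have h k : divides 'X_j (tnth [tuple 'X_k | k < r] k - tnth z k).
  rewrite !tnth_mktuple; case: eqP => [->|_]; last first.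
    by rewrite subrr; apply: divides0.
  by rewrite subr0; apply: divides_refl.
have := comp_mpoly_congr h (p \mPo ysubst w^-1%g).
rewrite comp_mpoly_id -[_ \mPo z]/(f p) fp0 subr0.
case=> q e; exists (q \mPo ysubst w).
have <- : (p \mPo ysubst w^-1%g) \mPo ysubst w = p.
  by rewrite -[in X in _ \mPo X](invgK w) ysubstK.
by rewrite e rmorphM /= -yroot_simple ysubst_root.
Qed.

Lemma yroot_prime i p q : divides (yroot i) (p * q) ->
  divides (yroot i) p \/ divides (yroot i) q.
Proof.
have [f fP] := yroot_ker i; rewrite -!fP rmorphM => /eqP.
by rewrite mulf_eq0 => /orP [] /eqP; [left | right].
Qed.

Lemma yroot_dvd_exp i m p q : ~ divides (yroot i) p ->
  divides (yroot i ^+ m) (p * q) -> divides (yroot i ^+ m) q.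
Proof.
move=> np; elim: m q => [|m IH] q; first by exists q; rewrite mulr1.
case=> c e; have [|//|[c' e']] := @yroot_prime i p q.
  by rewrite e exprSr mulrA; exists (c * yroot i ^+ m).
rewrite e' exprSr; apply: divides_mul; last exact: divides_refl.
apply: IH; exists c; apply: (mulIf (yroot_neq0 i)).
by rewrite -mulrA -e' e exprSr mulrA.
Qed.

Lemma yroot_ndvd2 i : ~ divides (yroot i) 2.
Proof.
case=> q /(congr1 (meval (fun=> 0))); rewrite rmorphM /=.
rewrite [X in _ * X]raddf_sum big1 => [|j _].
  by rewrite mulr0 rmorph_nat => /eqP; rewrite pnatr_eq0.
by rewrite raddfMz /= mevalXU mul0rz.
Qed.

Lemma msize_yroot i : msize (yroot i) = 2%N.
Proof.
have h : yroot i \is 1.-homog.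
  apply: rpred_sum => j _; rewrite -scaler_int; apply: dhomogZ.
  by rewrite dhomogX /= mdeg1.
by have /eqP := dhomog_uniq (yroot_neq0 i) h (dhomog_msize h); case: (msize _) => [|[|[]]].
Qed.

(** Such a quotient has degree 0, so that the two roots are proportional. *)
Lemma yroot_dvd i k : divides (yroot i) (yroot k) -> k = i \/ k = ropp W i.
Proof.
case=> q e.
have q0 : q != 0 by apply: contra_eq_neq e => ->; rewrite mul0r yroot_neq0.
have := congr1 (fun p => msize p) e; rewrite msizeM ?yroot_neq0 // !msize_yroot.
rewrite addn2 => - [sq]; have qc : q = (q@_0%MM)%:MP.
  by apply: msize1_polyC; rewrite -sq.
set c := q@_0%MM in qc.
apply: (@root_prop _ W k i c); rewrite (coord_root B k) (coord_root B i).
rewrite mulrz_suml; apply: eq_bigr => j _; rewrite -mulrzA; congr (_ *~ _).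
by rewrite -!mcoeff_yroot e qc mcoeffCM mulrC.
Qed.

Lemma yroot_dvd_prod i (s : seq (rd_ix Phi)) (P : pred (rd_ix Phi)) m :
  divides (yroot i) (\prod_(k <- s | P k) yroot k ^+ m) ->
  exists k, [/\ k \in s, P k & k = i \/ k = ropp W i].
Proof.
elim: s => [|k s IH].
  rewrite big_nil => h; case: (@yroot_ndvd2 i).
  by rewrite -[2]mul1r; apply: dividesMr.
rewrite big_cons; case: ifP => Pk; last first.
  by move/IH => [k' [ks Pk' h]]; exists k'; rewrite inE ks orbT.
case/yroot_prime => [|/IH [k' [ks Pk' h]]]; last first.
  by exists k'; rewrite inE ks orbT.
elim: m {IH} => [h|m IH].
  case: (@yroot_ndvd2 i).
  by rewrite -[2]mul1r; apply: dividesMr.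
rewrite exprS => /yroot_prime [] // /yroot_dvd h.
by exists k; rewrite inE eqxx.
Qed.

Lemma yroot_prod_exp (s : seq (rd_ix Phi)) m x : uniq s -> all rneg s ->
  (forall i, i \in s -> divides (yroot i ^+ m) x) ->
  divides (\prod_(i <- s) yroot i ^+ m) x.
Proof.
elim: s => [|i s IH] /=; first by move=> *; exists x; rewrite big_nil mulr1.
move=> /andP [is_ us] /andP [ineg sneg] h.
have [|q e] := IH us sneg; first by move=> k ks; apply: h; rewrite inE ks orbT.
rewrite big_cons e; apply: divides_mul; last exact: divides_refl.
apply: (@yroot_dvd_exp i m (\prod_(k <- s) yroot k ^+ m)).
  move/yroot_dvd_prod => [k [ks _ [ki|ki]]]; first by rewrite ki (negPf is_) in ks.
  by have /allP /(_ k ks) := sneg; rewrite ki (rneg_opp _ W) ineg.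
by rewrite mulrC -e; apply: h; rewrite inE eqxx.
Qed.

(** * Poles of products of Demazure elements *)

Definition yall : A := \prod_k yroot k.
(** Dividing by the root i amounts to multiplying by ybut i and dividing by yall;
    yall does not depend on i and is invariant under W. *)
Definition ybut (i : rd_ix Phi) : A := \prod_(k | k != i) yroot k.

Lemma ybutE i : yall = yroot i * ybut i.
Proof. by rewrite /yall (bigD1 i). Qed.

Lemma ropp_neq i : ropp W i != i.
Proof. by apply/eqP => /(congr1 rneg); rewrite (rneg_opp _ W); case: rneg. Qed.

Lemma ybut_opp i : ybut (ropp W i) = - ybut i.
Proof.
apply: (mulfI (yroot_neq0 i)); rewrite mulrN -ybutE (ybutE (ropp W i)) yroot_opp.
by rewrite mulNr opprK.
Qed.

(** The numerators, over yall ^+ size l, of the coefficients of the product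
    X_(g_m) ... X_(g_1), where l is g_1, ..., g_m.  Indeed multiplication by X_g on
    the right maps the family c of coefficients to (c u + c (u s_g)) / u(g). *)
Fixpoint numer (l : seq (rd_ix Phi)) (u : W) : A :=
  if l is g :: l' then
    (numer l' u + numer l' (u * refl g)%g) * ybut (wact u g)
  else (u == 1%g)%:R.

(** Since b occurs twice in yall, up to sign, P u / yall ^+ m has at most a simple
    pole along b, with opposite residues at u and s_b u. *)
Definition residue_cond b m (P : W -> A) := forall u,
  divides (yroot b ^+ (2 * m)) (yroot b * P u) /\
  divides (yroot b ^+ (2 * m)) (P u + P (refl b * u)%g).

Lemma ybut2E b i : i != b -> i != ropp W b ->
  ybut i = - (yroot b * yroot b) *
    \prod_(k | (k != i) && (k != b) && (k != ropp W b)) yroot k.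
Proof.
move=> ib irb; rewrite /ybut (bigD1 b) /=; last by rewrite eq_sym.
rewrite (bigD1 (ropp W b)) /=; last by rewrite eq_sym irb ropp_neq.
by rewrite yroot_opp mulrA mulrN.
Qed.

(** With multiplication on the right, the pole along b of the new coefficients only
    depends on the poles along the same b of the old ones; and when b occurs in the
    new denominator at u, it divides the sum of the old coefficients at u and
    s_b u, which has no pole. *)
Lemma residue_step b m P g : residue_cond b m P ->
  residue_cond b m.+1 (fun u => (P u + P (u * refl g)%g) * ybut (wact u g)).
Proof.
move=> h u; set i := wact u g; set y := yroot b.
have Eexp : y ^+ (2 * m.+1) = y ^+ (2 * m) * (y * y).
  by rewrite mulnS addnC exprD -expr2.
have us : (u * refl g = refl i * u)%g by rewrite refl_wact mulgKV.
have e1 : wact (refl b * u)%g g = wact (refl b) i by rewrite wactM.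
(* In the first case, the new factor of the denominator is b up to sign, and the
   terms at u and s_b u exchange the roles of u and u s_g. *)
have [bi|] := boolP ((i == b) || (i == ropp W b)).
  have ri : refl i = refl b by case/orP: bi => /eqP ->; rewrite ?refl_opp.
  have yi : divides y (ybut i).
    rewrite /ybut (bigD1 (ropp W i)) ?ropp_neq //= yroot_opp.
    apply: dividesMr; case/orP: bi => /eqP ->; rewrite ?yroot_opp ?opprK.
      exact/dividesN/divides_refl.
    exact: divides_refl.
  rewrite -mulgA us ri e1 mulgA weyl_reflK mul1g; split.
    rewrite Eexp [X in divides _ X]mulrCA; apply: divides_mul; first by case: (h u).
    by apply: divides_mul => //; apply: divides_refl.
  rewrite -ri -[wact _ i]/(ropp W i) ybut_opp mulrN [P _ + P u]addrC subrr.
  exact: divides0.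
rewrite negb_or => /andP [ib irb].
set i' := wact (refl b) i in e1.
have i'b : i' != b.
  apply: contraNneq irb => e; rewrite -[i](wactK (refl b)) -/i' e weyl_reflV.
  by [].
have i'rb : i' != ropp W b.
  apply: contraNneq ib => e; rewrite -[i](wactK (refl b)) -/i' e weyl_reflV.
  by rewrite -[wact _ _](roppK W) -wact_opp !roppK.
rewrite e1 (ybut2E ib irb) (ybut2E i'b i'rb) -/y.
set D := \prod_(k | _ && _) _; set D' := \prod_(k | _ && _) _.
(* Otherwise the new denominators i and i' are prime to b, and congruent modulo b
   as i' = s_b(i). *)
have [c Dc] : divides y (D - D').
  have : divides y (yroot i * (D - D')).
    have -> : yroot i * (D - D') = (yroot i' - yroot i) * D'.
      have e : yroot i * D = yroot i' * D'.
        have sw (k : rd_ix Phi) : k != b -> k != ropp W b ->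
            yroot k * \prod_(l | (l != k) && (l != b) && (l != ropp W b)) yroot l
            = \prod_(l | (l != b) && (l != ropp W b)) yroot l.
          move=> kb krb; rewrite [RHS](bigD1 k) /= ?kb //; congr (_ * _).
          by apply: eq_bigl => l; rewrite -andbA andbC.
        by rewrite !sw.
      by rewrite mulrBr mulrBl e.
    rewrite (yroot_sub (root_refl_wact W b i)) addrC addKr.
    apply: dividesMr; rewrite -mulrzl.
    by apply/dividesN/dividesMl/divides_refl.
  by case/yroot_prime => // /yroot_dvd [] e; rewrite e eqxx ?roppK in ib irb.
have Pm v : divides (y ^+ (2 * m)) (y * P v) by case: (h v).
have Ps v : divides (y ^+ (2 * m)) (P v + P (refl b * v)%g) by case: (h v).
rewrite Eexp; split.
  have -> : y * ((P u + P (u * refl g)%g) * (- (y * y) * D)) =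
    (y * P u + y * P (u * refl g)%g) * (y * y) * (- D) by ring.
  apply/dividesMr/divides_mul; last exact: divides_refl.
  by apply: dividesD; apply: Pm.
have -> : (P u + P (u * refl g)%g) * (- (y * y) * D) +
  (P (refl b * u)%g + P (refl b * u * refl g)%g) * (- (y * y) * D') =
  ((P u + P (refl b * u)%g + (P (u * refl g)%g + P (refl b * (u * refl g))%g)) * D
   - (D - D') * (P (refl b * u)%g + P (refl b * u * refl g)%g)) * (y * y) * -1.
  by rewrite mulgA; ring.
apply/dividesMr/divides_mul; last exact: divides_refl.
apply: dividesB; first by apply/dividesMr/dividesD; apply: Ps.
by rewrite Dc -mulrA mulrDr; apply/dividesMl/dividesD; apply: Pm.
Qed.

Lemma residue_numer b l : residue_cond b (size l) (numer l).
Proof.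
elim: l => [|g l IH] /=; last exact: residue_step.
by move=> u; split; rewrite muln0 expr0; eexists; rewrite mulr1.
Qed.

Variable J : {set 'I_r}.
Local Notation WL := (weyl_levi W J).

(** The sum over W_P has no pole along a root b of the Levi subgroup, because s_b
    pairs its terms; along the other roots its poles are at most simple.  The
    orders of the poles can be put together as the roots are distinct primes. *)
Lemma numer_levi_sum l :
  divides (yall ^+ size l)
    ((\prod_(i in neg_roots B :\: levi_roots J) yroot i) *
     \sum_(u in WL) numer l u).
Proof.
set E := \prod_(i in _) _; set C := \sum_(u in _) _; set m := size l.
have h b : rneg b -> divides (yroot b ^+ (2 * m)) (E * C).
  move=> bneg; have [bL|bL] := boolP (levi J b).
    (* twice the sum is a sum of pairs, and b does not divide 2 *)
    apply: dividesMl; apply: (@yroot_dvd_exp b _ 2 C (@yroot_ndvd2 b)).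
    have -> : 2 * C = \sum_(u in WL) (numer l u + numer l (refl b * u)%g).
      rewrite big_split /= mulr_natl mulr2n; congr (_ + _).
      rewrite /C (reindex_inj (mulgI (refl b))) /=; apply: eq_bigl => u.
      by rewrite groupMl // mem_gen // imset_f.
    by apply: divides_sum => u _; case: (residue_numer b l u).
  rewrite /E (bigD1 b) /=; last by rewrite inE bL.
  rewrite mulrAC; apply: dividesMr; rewrite mulr_sumr.
  by apply: divides_sum => u _; case: (residue_numer b l u).
have e : yall = \prod_(i in neg_roots B) (- 1) * \prod_(i in neg_roots B) yroot i ^+ 2.
  rewrite /yall (bigID (mem (neg_roots B))) /=.
  rewrite [X in _ * X](reindex_inj (inv_inj (roppK W))) /=.
  rewrite [X in _ * X](eq_bigl (mem (neg_roots B))) => [|i]; last first.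
    by rewrite -/(rneg _) (rneg_opp _ W) negbK.
  rewrite -!big_split /=; apply: eq_bigr => i _.
  by rewrite yroot_opp; ring.
have : divides (\prod_(i in neg_roots B) yroot i ^+ (2 * m)) (E * C).
  rewrite -big_enum /=; apply: yroot_prod_exp; rewrite ?enum_uniq //.
    by apply/allP => i; rewrite mem_enum.
  by move=> i; rewrite mem_enum => /h.
rewrite e exprMn -prodrXl.
under eq_bigr do rewrite exprM.
rewrite prodrXl => [] [q ->].
exists (q * (\prod_(i in neg_roots B) -1) ^+ m).
rewrite -mulrA [X in _ = _ * X]mulrA -exprMn -big_split /=.
rewrite [X in X ^+ m * _]big1 => [|i _]; last by ring.
by rewrite expr1n mul1r -prodrXl.
Qed.

End RootPrimes.

(** * The symmetric algebra of the character lattice *)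

Section SymmetricAlgebra.

Variables (R : comNzRingType) (Phi : root_datum) (W : weyl_group Phi).
Local Notation n := (rd_rank Phi).
Local Notation S := {mpoly R[n]}.
Local Notation refl := (weyl_refl W).
Local Notation xr := (xroot R).

Lemma xcharB (l k : 'cV[int]_n) : xchar R (l - k) = xchar R l - xchar R k.
Proof.
by rewrite /xchar -sumrB; apply: eq_bigr => i _; rewrite !mxE mulrzBr.
Qed.

Lemma col_mulz (l : 'cV[int]_n) z i : (l *~ z) i 0 = l i 0 * z.
Proof. by rewrite -scaler_int mxE intz mulrC. Qed.

Lemma xcharMz (l : 'cV[int]_n) z : xchar R (l *~ z) = xchar R l *~ z.
Proof.
rewrite /xchar mulrz_suml; apply: eq_bigr => i _.
by rewrite col_mulz mulrzA.
Qed.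

Lemma xchar_sum (I : finType) (F : I -> 'cV[int]_n) :
  xchar R (\sum_i F i) = \sum_i xchar R (F i).
Proof.
rewrite /xchar exchange_big /=; apply: eq_bigr => j _.
by rewrite summxE mulrz_sumr.
Qed.

Definition stuple (w : W) : n.-tuple S :=
  [tuple xchar R (col i (weyl_mx w)) | i < n].

HB.instance Definition _ (w : W) := GRing.RMorphism.copy
  (@sact R Phi W w) (comp_mpoly (stuple w)).

Lemma sact_xchar (w : W) (l : 'cV[int]_n) : sact w (xchar R l) = xchar R (weyl_mx w *m l).
Proof.
rewrite {1}/xchar raddf_sum /=.
under eq_bigr => i _ do
  rewrite raddfMz /= /sact comp_mpolyXU -tnth_nth tnth_mktuple -xcharMz.
rewrite -xchar_sum; congr xchar; apply/colP => j.
rewrite summxE mxE; apply: eq_bigr => i _.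
by rewrite col_mulz mxE mulrC.
Qed.

Lemma sact_xroot (w : W) i : sact w (xr i) = xr (wact w i).
Proof. by rewrite /xroot sact_xchar root_wact. Qed.

Lemma sactM (u w : W) (s : S) : sact u (sact w s) = sact (u * w)%g s.
Proof.
rewrite /sact comp_mpolyA; congr comp_mpoly; apply: eq_from_tnth => i.
rewrite !tnth_mktuple -[_ \mPo _]/(sact u _) sact_xchar weyl_mxM.
by congr xchar; apply/colP => j; rewrite !mxE; apply: eq_bigr => k _; rewrite mxE.
Qed.

Lemma xchar_delta (j : 'I_n) : xchar R (col j 1%:M : 'cV[int]_n) = 'X_j.
Proof.
rewrite /xchar (bigD1 j) //= big1 ?addr0 => [|k kj].
  by rewrite !mxE eqxx mulr1z.
by rewrite !mxE (negPf kj) mulr0z.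
Qed.

Lemma sact1 (s : S) : sact (1%g : W) s = s.
Proof.
rewrite /sact -[RHS]comp_mpoly_id; congr comp_mpoly.
by apply: eq_from_tnth => i; rewrite !tnth_mktuple weyl_mx1 xchar_delta.
Qed.

(** The reflection s_i is trivial modulo the root i. *)
Lemma sact_refl_congr i s : divides (xr i) (s - sact (refl i) s).
Proof.
rewrite -{1}[s]comp_mpoly_id; apply: comp_mpoly_congr => j.
rewrite !tnth_mktuple -xchar_delta -xcharB weyl_reflE /refl_mx.
have -> : col j 1%:M - col j (1%:M - root i *m coroot i) =
          root i *~ coroot i 0 j.
  by apply/colP => k; rewrite col_mulz !mxE big_ord1 opprB addrC subrK.
by rewrite xcharMz -mulrzl; apply/dividesMl/divides_refl.
Qed.

Hypothesis two_regular : forall x : R, 2 * x = 0 -> x = 0.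

(** The translation of the variables by t times the coroot maps the root x to
    x + 2t, which is regular as a polynomial in t because its leading coefficient
    is 2. *)
Lemma xroot_regular i (p : S) : p * xr i = 0 -> p = 0.
Proof.
(* the translation; {poly S} is the ring S[t] *)
pose f : {rmorphism S -> {poly S}} :=
  mmap (@polyC S \o @mpolyC n R) (fun j => ('X_j)%:P + 'X *~ coroot i 0 j).
have fX : f (xr i) = (xr i)%:P + 'X *+ 2.
  rewrite /xroot /xchar !raddf_sum /=.
  under eq_bigr => j _ do rewrite raddfMz /= mmapX mmap1U mulrzDl -mulrzA.
  rewrite big_split /= -mulrz_sumr; congr (_ + _).
    by apply: eq_bigr => j _; rewrite raddfMz.
  rewrite pmulrn; congr (_ *~ _); have := root_coroot i.
  by rewrite mxE natz.
have f0 q : (f q).[0] = q.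
  rewrite -[RHS]comp_mpoly_id; elim/mpolyind: q => [|c m q _ _ IH].
    by rewrite (raddf0 f) comp_mpoly0 horner0.
  rewrite (raddfD f) hornerD comp_mpolyD -IH; congr (_ + _).
  rewrite /f /= mmapZ comp_mpolyZ /= hornerM hornerC mul_mpolyC; congr (_ *: _).
  rewrite mmapX comp_mpolyX /mmap1 horner_prod; apply: eq_bigr => j _.
  rewrite horner_exp hornerD hornerC tnth_mktuple.
  by rewrite -mulrzl hornerM hornerX mulr0 addr0.
move=> p0; have : f p * f (xr i) = 0 by rewrite -rmorphM p0 raddf0.
have two0 (c : S) : c *+ 2 = 0 -> c = 0.
  move=> c0; apply/mpolyP => m; rewrite mcoeff0; apply: two_regular.
  by rewrite mulr_natl -mcoeffMn c0 mcoeff0.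
have szX : size ('X *+ 2 : {poly S}) = 2%N.
  have n2 : (2 : S) != 0.
    by apply/eqP => /two0 /eqP; rewrite oner_eq0.
  have -> : 'X *+ 2 = (2 : S)%:P * 'X :> {poly S}.
    by rewrite polyC_natr mulr_natl.
  by rewrite size_mulX ?polyC_eq0 // size_polyC n2.
rewrite fX => fp0; have fp : f p = 0; last by rewrite -(f0 p) fp horner0.
have /(_ (f p) 0) : GRing.rreg ((xr i)%:P + 'X *+ 2).
  apply: rreg_lead; rewrite lead_coefDr ?szX; last first.
    exact: leq_ltn_trans (size_polyC_leq1 _) _.
  rewrite lead_coefE szX coefMn coefX => c c' /= e.
  apply/eqP; rewrite -subr_eq0; apply/eqP/two0.
  by rewrite -mulr_natr mulrBl e subrr.
by apply; rewrite fp0 mul0r.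
Qed.

End SymmetricAlgebra.

(** * The localization and the twisted group algebra *)

Section TwistedAlgebra.

Variables (R : comNzRingType) (Phi : root_datum) (W : weyl_group Phi).
Variable Q : root_localization R Phi.
Local Notation n := (rd_rank Phi).
Local Notation S := {mpoly R[n]}.
Local Notation refl := (weyl_refl W).
Local Notation xr := (xroot R).
Local Notation QW := (QW W Q).
Local Notation emb := (emb Q).
Local Notation inS := (@inS R Phi Q).
Local Notation qact := (@Defs.qact R Phi W Q).

Definition xprod (m : seq (rd_ix Phi)) : S := \prod_(i <- m) xr i.

Lemma emb_xprod m : emb (xprod m) = \prod_(i <- m) emb (xr i).
Proof. exact: rmorph_prod. Qed.

Lemma emb_xprod_unit m : emb (xprod m) \is a GRing.unit.
Proof.
rewrite emb_xprod; elim: m => [|i m IH]; first by rewrite big_nil unitr1.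
by rewrite big_cons unitrM emb_root_unit.
Qed.

Lemma sact_xprod (w : W) m : sact w (xprod m) = xprod (map (wact w) m).
Proof.
rewrite /xprod rmorph_prod big_map; apply: eq_bigr => i _.
exact: sact_xroot.
Qed.

Lemma fracP (q : Q) : exists s m, q = emb s / emb (xprod m).
Proof.
by have [[s m] /= /eqP e] := emb_frac q; exists s, m; rewrite emb_xprod.
Qed.

Lemma frac_eq (a b c d : Q) : b \is a GRing.unit -> d \is a GRing.unit ->
  (a / b == c / d) = (a * d == c * b).
Proof.
move=> bu du; rewrite -(inj_eq (mulIr bu)) divrK // -(inj_eq (mulIr du)).
by rewrite mulrAC divrK.
Qed.

(** Equal in Q means equal in S up to a product of roots, and W permutes the
    roots; so W also acts on fractions. *)
Lemma emb_sact (w : W) s s' : emb s = emb s' -> emb (sact w s) = emb (sact w s').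
Proof.
move=> e; have [m em] : exists m, (s - s') * xprod m = 0.
  apply: emb_eq0; have h : emb (s - s') = 0 by rewrite rmorphB e subrr.
  exact: h.
apply/eqP; rewrite -subr_eq0 -rmorphB -rmorphB.
rewrite -(inj_eq (mulIr (emb_xprod_unit (map (wact w) m)))) mul0r.
by rewrite -sact_xprod -rmorphM -rmorphM em !rmorph0.
Qed.

Lemma qact_frac (w : W) s m :
  qact w (emb s / emb (xprod m)) = emb (sact w s) / emb (xprod (map (wact w) m)).
Proof.
rewrite /Defs.qact; set q := emb s / _.
have := xchooseP (emb_frac q).
case: (xchoose (emb_frac q)) => s' m' /= /eqP.
rewrite -emb_xprod => /eqP; rewrite frac_eq ?emb_xprod_unit // -!rmorphM.
move/eqP/(emb_sact w) => e.
have -> : \prod_(i <- m') emb (sact w (xr i)) = emb (sact w (xprod m')).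
  by rewrite sact_xprod emb_xprod big_map; apply: eq_bigr => i _; rewrite sact_xroot.
rewrite sact_xprod; apply/eqP; rewrite frac_eq ?emb_xprod_unit //.
by rewrite -!sact_xprod -!rmorphM -e.
Qed.

Lemma qact_emb (w : W) s : qact w (emb s) = emb (sact w s).
Proof.
have := qact_frac w s [::]; rewrite /= /xprod big_nil.
by rewrite rmorph1 !divr1.
Qed.

Lemma qact_is_zmod_morphism w : zmod_morphism (qact w).
Proof.
move=> x y; have [s [m ->]] := fracP x; have [t [k ->]] := fracP y.
have -> : emb s / emb (xprod m) - emb t / emb (xprod k) =
  emb (s * xprod k - t * xprod m) / emb (xprod (m ++ k)).
  have -> : xprod (m ++ k) = xprod m * xprod k by rewrite /xprod big_cat.
  rewrite rmorphB !rmorphM mulrBl; congr (_ - _).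
    by rewrite -mulrA invrM ?emb_xprod_unit // mulVKr ?emb_xprod_unit.
  apply/eqP; rewrite frac_eq ?unitrM ?emb_xprod_unit //.
  by rewrite mulrA mulrAC.
rewrite !qact_frac map_cat.
have -> : xprod (map (wact w) m ++ map (wact w) k) =
  sact w (xprod m) * sact w (xprod k) by rewrite !sact_xprod /xprod big_cat.
rewrite -!sact_xprod rmorphB !rmorphM rmorphB !rmorphM mulrBl.
have um := emb_xprod_unit (map (wact w) m).
have uk := emb_xprod_unit (map (wact w) k).
rewrite -sact_xprod in um; rewrite -sact_xprod in uk.
congr (_ - _); apply/eqP; rewrite frac_eq ?unitrM ?um ?uk //.
  by rewrite mulrAC mulrA.
by rewrite mulrA mulrAC.
Qed.

Lemma qact_is_monoid_morphism w : monoid_morphism (qact w).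
Proof.
split; first by rewrite -(rmorph1 emb) qact_emb !rmorph1.
move=> x y; have [s [m ->]] := fracP x; have [t [k ->]] := fracP y.
have -> : emb s / emb (xprod m) * (emb t / emb (xprod k)) =
  emb (s * t) / emb (xprod (m ++ k)).
  have -> : xprod (m ++ k) = xprod m * xprod k by rewrite /xprod big_cat.
  by rewrite !rmorphM invrM ?emb_xprod_unit // mulrACA [_^-1 * _]mulrC.
rewrite !qact_frac map_cat.
have -> : xprod (map (wact w) m ++ map (wact w) k) =
  xprod (map (wact w) m) * xprod (map (wact w) k) by rewrite /xprod big_cat.
by rewrite !rmorphM invrM ?emb_xprod_unit // [X in _ * X = _]mulrC mulrACA.
Qed.

HB.instance Definition _ w :=
  GRing.isZmodMorphism.Build Q Q (qact w) (qact_is_zmod_morphism w).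
HB.instance Definition _ w :=
  GRing.isMonoidMorphism.Build Q Q (qact w) (qact_is_monoid_morphism w).

Lemma qactM u w q : qact u (qact w q) = qact (u * w)%g q.
Proof.
have [s [m ->]] := fracP q; rewrite !qact_frac sactM -map_comp.
by congr (_ / emb (xprod _)); apply: eq_map => i /=; rewrite wactM.
Qed.

Lemma qact1 q : qact 1%g q = q.
Proof.
have [s [m ->]] := fracP q; rewrite !qact_frac sact1.
by congr (_ / emb (xprod _)); rewrite -[RHS]map_id; apply: eq_map => i /=; rewrite wact1.
Qed.

Lemma qactK w : cancel (qact w) (qact w^-1%g).
Proof. by move=> q; rewrite qactM mulVg qact1. Qed.

Lemma qactVK w : cancel (qact w^-1%g) (qact w).
Proof. by move=> q; rewrite qactM mulgV qact1. Qed.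

Lemma qact_root w i : qact w (emb (xr i)) = emb (xr (wact w i)).
Proof. by rewrite qact_emb sact_xroot. Qed.

Lemma inS_emb s : inS (emb s). Proof. by exists s. Qed.

Lemma inS0 : inS 0. Proof. by exists 0; rewrite rmorph0. Qed.

Lemma inS1 : inS 1. Proof. by exists 1; rewrite rmorph1. Qed.

Lemma inSD x y : inS x -> inS y -> inS (x + y).
Proof. by case=> s -> [t ->]; exists (s + t); rewrite rmorphD. Qed.

Lemma inSN x : inS x -> inS (- x).
Proof. by case=> s ->; exists (- s); rewrite rmorphN. Qed.

Lemma inSB x y : inS x -> inS y -> inS (x - y).
Proof. by move=> hx hy; apply/inSD/inSN. Qed.

Lemma inSM x y : inS x -> inS y -> inS (x * y).
Proof. by case=> s -> [t ->]; exists (s * t); rewrite rmorphM. Qed.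

Lemma inS_sum (I : Type) (r : seq I) (P : pred I) (F : I -> Q) :
  (forall i, P i -> inS (F i)) -> inS (\sum_(i <- r | P i) F i).
Proof. by move=> h; apply: big_ind => //; [apply: inS0 | apply: inSD]. Qed.

Lemma inS_qact w x : inS x -> inS (qact w x).
Proof. by case=> s ->; rewrite qact_emb; apply: inS_emb. Qed.

Lemma inS_demazure i x : inS x ->
  inS ((emb (xr i))^-1 * (x - qact (refl i) x)).
Proof.
case=> s ->; rewrite qact_emb -rmorphB.
have [q ->] := @sact_refl_congr R Phi W i s.
exists q; rewrite rmorphM mulrC mulrK //; exact: emb_root_unit.
Qed.

Implicit Types x y z : QW.

Lemma deltaE (q : Q) (w u : W) : delta q w u = if u == w then q else 0.
Proof. by rewrite ffunE. Qed.

Lemma mulQWE x y u : mulQW x y u = \sum_w x w * qact w (y (w^-1 * u)%g).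
Proof.
rewrite /mulQW sum_ffunE; apply: eq_bigr => w _; rewrite sum_ffunE.
rewrite (bigD1 (w^-1 * u)%g) //= deltaE mulKVg eqxx big1 ?addr0 // => v vu.
rewrite deltaE; case: eqP => // e; case/eqP: vu.
by rewrite e mulKg.
Qed.

Lemma mulQWA x y z : mulQW x (mulQW y z) = mulQW (mulQW x y) z.
Proof.
apply/ffunP => u; rewrite !mulQWE.
under eq_bigr => w _ do rewrite mulQWE raddf_sum mulr_sumr.
under [RHS]eq_bigr => w _ do rewrite mulQWE mulr_suml.
rewrite [RHS]exchange_big /=; apply: eq_bigr => w _.
rewrite [RHS](reindex_inj (mulgI w)) /=; apply: eq_bigr => v _.
by rewrite rmorphM /= qactM mulKg invMg mulgA mulrA.
Qed.

Lemma mulQWDl x y z : mulQW (x + y) z = mulQW x z + mulQW y z.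
Proof.
apply/ffunP => u; rewrite ffunE !mulQWE -big_split; apply: eq_bigr => w _.
by rewrite ffunE mulrDl.
Qed.

Lemma mulQWDr x y z : mulQW x (y + z) = mulQW x y + mulQW x z.
Proof.
apply/ffunP => u; rewrite ffunE !mulQWE -big_split; apply: eq_bigr => w _.
by rewrite ffunE raddfD mulrDr.
Qed.

Lemma mulQWNl x z : mulQW (- x) z = - mulQW x z.
Proof.
apply/ffunP => u; rewrite ffunE !mulQWE -sumrN; apply: eq_bigr => w _.
by rewrite ffunE mulNr.
Qed.

Lemma mulQWNr x z : mulQW x (- z) = - mulQW x z.
Proof.
apply/ffunP => u; rewrite ffunE !mulQWE -sumrN; apply: eq_bigr => w _.
by rewrite ffunE raddfN mulrN.
Qed.

Lemma mulQWBl x y z : mulQW (x - y) z = mulQW x z - mulQW y z.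
Proof. by rewrite mulQWDl mulQWNl. Qed.

Lemma mul_deltaE q w y u : mulQW (delta q w) y u = q * qact w (y (w^-1 * u)%g).
Proof.
rewrite mulQWE (bigD1 w) //= deltaE eqxx big1 ?addr0 // => v vw.
by rewrite deltaE (negPf vw) mul0r.
Qed.

Lemma mul_delta q1 w1 q2 w2 : mulQW (delta q1 w1) (delta q2 w2) =
  delta (q1 * qact w1 q2) (w1 * w2)%g :> QW.
Proof.
apply/ffunP => u; rewrite mul_deltaE !deltaE -(inj_eq (mulgI w1)) mulKVg.
by case: eqP => // _; rewrite rmorph0 mulr0.
Qed.

Lemma mul_delta1l y : mulQW (delta 1 1%g) y = y.
Proof. by apply/ffunP => u; rewrite mul_deltaE mul1r qact1 invg1 mul1g. Qed.

Lemma mul_delta1r y : mulQW y (delta 1 1%g) = y.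
Proof.
apply/ffunP => u; rewrite mulQWE (bigD1 u) //= mulVg deltaE eqxx.
rewrite rmorph1 mulr1 big1 ?addr0 // => v vu; rewrite deltaE.
case: eqP => [/eqP|_]; last by rewrite rmorph0 mulr0.
by rewrite -eq_invg_mul invgK => /eqP e; rewrite e eqxx in vu.
Qed.

Local Notation X_ i := (demazure W Q i).

Lemma demazure_mulE i y u : mulQW (X_ i) y u =
  (emb (xr i))^-1 * (y u - qact (refl i) (y (refl i * u)%g)).
Proof.
rewrite mulQWBl !ffunE !mul_deltaE invg1 mul1g qact1 weyl_reflV mulrBr.
by [].
Qed.

Lemma inD_delta w : inD (delta 1 w : QW).
Proof.
have h1 : inD (delta 1 1%g : QW) by rewrite -(rmorph1 emb); apply: inD_S.
have hr i : inD (delta 1 (refl i) : QW).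
  have -> : delta 1 (refl i) = delta 1 1%g - mulQW (delta (emb (xr i)) 1%g) (X_ i) :> QW.
    apply/ffunP => u; rewrite !ffunE mul_deltaE qact1 invg1 mul1g !ffunE.
    rewrite mulrBr !(fun_if (fun q => emb (xr i) * q)) mulr0.
    by rewrite mulrV ?emb_root_unit // opprB addrC subrK.
  by apply: inD_sub => //; apply: inD_mul; [apply: inD_S | apply: inD_X].
have : w \in <<[set refl i | i : rd_ix Phi]>>%g by rewrite weyl_gen inE.
case/gen_prodgP => k [c cP ->].
elim: k c cP => [|k IH] c cP; first by rewrite big_ord0.
rewrite big_ord_recl; have /imsetP [i _ ->] := cP ord0.
set w' := (\prod_(_ < _) _)%g.
have -> : delta 1 (refl i * w')%g = mulQW (delta 1 (refl i)) (delta 1 w') :> QW.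
  by rewrite mul_delta mul1r rmorph1.
by apply: inD_mul => //; apply: (IH (fun j => c (lift ord0 j))).
Qed.

(** * A spanning family of the nil affine Hecke algebra *)

(** The factors are in the order of the words in numer. *)
Definition xmon (l : seq (rd_ix Phi)) : QW :=
  foldr (fun g y => mulQW y (X_ g)) (delta 1 1%g) l.

Definition smon (s : S) l : QW := mulQW (delta (emb s) 1%g) (xmon l).

Definition in_span x := exists c : seq (S * seq (rd_ix Phi)),
  x = \sum_(p <- c) smon p.1 p.2.

Lemma in_spanD x y : in_span x -> in_span y -> in_span (x + y).
Proof. by case=> c -> [d ->]; exists (c ++ d); rewrite big_cat. Qed.

Lemma in_span_smon s l : in_span (smon s l).
Proof. by exists [:: (s, l)]; rewrite big_seq1. Qed.

Lemma in_span0 : in_span 0.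
Proof. by exists [::]; rewrite big_nil. Qed.

Lemma mul_span x y : (forall s l, in_span (mulQW x (smon s l))) -> in_span y ->
  in_span (mulQW x y).
Proof.
move=> h [c ->]; elim: c => [|p c IH].
  rewrite big_nil; have -> : mulQW x 0 = 0; last exact: in_span0.
  by rewrite -[0](subrr x) mulQWDr mulQWNr !subrr.
by rewrite big_cons mulQWDr; apply: in_spanD.
Qed.

Lemma xmon_rcons l g : mulQW (X_ g) (xmon l) = xmon (rcons l g).
Proof.
elim: l => [|k l IH] /=; first by rewrite mul_delta1l mul_delta1r.
by rewrite -IH mulQWA.
Qed.

(** By the relation X_i s = s_i(s) X_i + X_i(s) scalars can be moved to the left. *)
Lemma inD_span x : inD x -> in_span x.
Proof.
move=> xD; rewrite -[x]mul_delta1r.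
have : in_span (delta 1 1%g).
  have := in_span_smon 1 [::]; rewrite /smon rmorph1 mul_delta1l //.
move: (delta 1 1%g); elim: xD => {x} [s|i|x y _ IHx _ IHy|x y _ IHx _ IHy] z zs.
- apply: mul_span zs => t l; rewrite /smon mulQWA mul_delta mulg1 qact1 -rmorphM.
  exact: in_span_smon.
- apply: mul_span zs => s l.
  have [q e] := @sact_refl_congr R Phi W i s.
  (* q is X_i(s) *)
  have -> : mulQW (X_ i) (smon s l) =
      smon (sact (refl i) s) (rcons l i) + smon q l.
    rewrite /smon -xmon_rcons !mulQWA -mulQWDl; congr mulQW.
    rewrite /demazure mulQWBl !mul_delta qact1 mul1g mulg1.
    have -> : mulQW (delta (emb (sact (refl i) s)) 1%g)
      (delta (emb (xr i))^-1 1%g - delta (emb (xr i))^-1 (refl i)) =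
      delta (emb (sact (refl i) s) * (emb (xr i))^-1) 1%g -
      delta (emb (sact (refl i) s) * (emb (xr i))^-1) (refl i) :> QW.
      by rewrite mulQWDr mulQWNr !mul_delta !qact1 !mul1g.
    rewrite qact_emb addrAC [emb (sact _ _) * _]mulrC; congr (_ - _).
    apply/ffunP => u; rewrite !ffunE; case: eqP => _; last by rewrite addr0.
    have -> : emb q = (emb (xr i))^-1 * emb (s - sact (refl i) s).
      by rewrite e rmorphM mulrC mulrK // emb_root_unit.
    by rewrite rmorphB mulrBr addrC subrK.
  by apply: in_spanD; apply: in_span_smon.
- rewrite mulQWBl; apply: in_spanD; first exact: IHx.
  have [c ->] := IHy _ zs; exists [seq (- p.1, p.2) | p <- c].
  rewrite big_map -sumrN; apply: eq_bigr => p _ /=.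
  rewrite /smon rmorphN -mulQWNl; congr mulQW; apply/ffunP => u.
  by rewrite !ffunE; case: ifP; rewrite ?oppr0.
- by rewrite -mulQWA; apply/IHx/IHy.
Qed.

End TwistedAlgebra.

(** * The module dual to D_P *)

Section DualModule.

Variables (R : comNzRingType) (Phi : root_datum) (B : base Phi).
Variables (W : weyl_group Phi) (Q : root_localization R Phi).
Variable J : {set 'I_(b_size B)}.
Local Notation S := {mpoly R[rd_rank Phi]}.
Local Notation refl := (weyl_refl W).
Local Notation al := (@simple _ B).
Local Notation xr := (xroot R).
Local Notation QW := (QW W Q).
Local Notation emb := (emb Q).
Local Notation inS := (@inS R Phi Q).
Local Notation qact := (@Defs.qact R Phi W Q).
Local Notation WL := (weyl_levi W J).
Local Notation WP := (WP W J).
Local Notation bar := (@bar _ B W J).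
Local Notation QWPdual := (QWPdual W Q J).
Local Notation odot := (@odot R Phi B W Q J).
Local Notation inD := (@inD R Phi W Q).
Local Notation X_ i := (demazure W Q i).
Implicit Types (f g : QWPdual) (x y z : QW).

(** This turns Q_{W/W_P}^* into the right W_P-invariants of Q_W, with the action
    of Q_W by left multiplication. *)
Definition pull f : QW := [ffun u => f (bar u)].

Lemma odotE x f v :
  odot x f v = \sum_w x w * qact w (f (bar (w^-1 * val v)%g)).
Proof.
rewrite /Defs.odot sum_ffunE; apply: eq_bigr => w _; rewrite sum_ffunE.
rewrite (bigD1 (bar (w^-1 * val v)%g)) //= ffunE bar_mull mulKVg barK eqxx.
rewrite big1 ?addr0 // => u uv; rewrite ffunE; case: eqP => // e; case/eqP: uv.
by rewrite e bar_mull mulKg barK.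
Qed.

Lemma pull_odot x f : pull (odot x f) = mulQW x (pull f).
Proof.
apply/ffunP => u; rewrite ffunE odotE mulQWE; apply: eq_bigr => w _.
by rewrite ffunE bar_mull.
Qed.

Lemma pull_val f v : pull f (val v) = f v.
Proof. by rewrite ffunE barK. Qed.

Lemma pull_inj : injective pull.
Proof. by move=> f g e; apply/ffunP => v; rewrite -!pull_val e. Qed.

Lemma pullD f g : pull (f + g) = pull f + pull g.
Proof. by apply/ffunP => v; rewrite !ffunE. Qed.

Lemma pullN f : pull (- f) = - pull f.
Proof. by apply/ffunP => v; rewrite !ffunE. Qed.

Lemma odotA x y f : odot x (odot y f) = odot (mulQW x y) f.
Proof. by apply: pull_inj; rewrite !pull_odot mulQWA. Qed.

Lemma odotDr x f g : odot x (f + g) = odot x f + odot x g.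
Proof. by apply: pull_inj; rewrite pullD !pull_odot pullD mulQWDr. Qed.

Lemma odotNr x f : odot x (- f) = - odot x f.
Proof. by apply: pull_inj; rewrite pullN !pull_odot pullN mulQWNr. Qed.

Lemma odotBr x f g : odot x (f - g) = odot x f - odot x g.
Proof. by rewrite odotDr odotNr. Qed.

Lemma odotBl x y f : odot (x - y) f = odot x f - odot y f.
Proof. by apply: pull_inj; rewrite pullD pullN !pull_odot mulQWBl. Qed.

Lemma odot1 f : odot (delta 1 1%g) f = f.
Proof. by apply: pull_inj; rewrite pull_odot mul_delta1l. Qed.

Lemma odot_deltaE q w f v :
  odot (delta q w) f v = q * qact w (f (bar (w^-1 * val v)%g)).
Proof. by rewrite -pull_val pull_odot mul_deltaE ffunE. Qed.

Lemma odot_scaleE q f v : odot (delta q 1%g) f v = q * f v.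
Proof. by rewrite odot_deltaE qact1 invg1 mul1g barK. Qed.

Lemma odot_demazureE i f v : odot (X_ i) f v =
  (emb (xr i))^-1 * (f v - qact (refl i) (f (bar (refl i * val v)%g))).
Proof. by rewrite -pull_val pull_odot demazure_mulE !ffunE barK. Qed.

Definition ev f x : Q := eval f (projQ J x).

Lemma evE f x : ev f x = \sum_w pull f w * x w.
Proof.
rewrite /ev /eval (partition_big bar xpredT) //=; apply: eq_bigr => v _.
rewrite ffunE mulr_sumr; apply: eq_bigr => w /eqP <-.
by rewrite ffunE.
Qed.

Lemma ev_delta q w f x :
  ev f (mulQW (delta q w) x) = q * qact w (ev (odot (delta 1 w^-1%g) f) x).
Proof.
rewrite !evE rmorph_sum mulr_sumr /= (reindex_inj (mulgI w)) /=.
apply: eq_bigr => u _; rewrite mul_deltaE mulKg pull_odot mul_deltaE mul1r.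
by rewrite invgK rmorphM /= qactVK mulrCA.
Qed.

Lemma ev_scale q f x : ev (odot (delta q 1%g) f) x = q * ev f x.
Proof.
rewrite !evE mulr_sumr; apply: eq_bigr => u _.
by rewrite pull_odot mul_deltaE qact1 invg1 mul1g mulrA.
Qed.

(** The twisted Leibniz rule for the difference quotient at the root i, applied to
    the pairing *)
Lemma ev_demazure i f x : ev (odot (X_ i) f) x = ev f (mulQW (X_ i) x) +
  (emb (xr i))^-1 * (ev f (mulQW (delta 1 (refl i)) x) -
                     qact (refl i) (ev f (mulQW (delta 1 (refl i)) x))).
Proof.
have -> : qact (refl i) (ev f (mulQW (delta 1 (refl i)) x)) =
    \sum_w qact (refl i) (pull f (refl i * w)%g) * x w.
  rewrite evE rmorph_sum /= (reindex_inj (mulgI (refl i))) /=.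
  apply: eq_bigr => u _; rewrite mul_deltaE mul1r mulKg rmorphM /=.
  by rewrite qactM weyl_reflK qact1.
rewrite !evE -sumrB mulr_sumr -big_split /=; apply: eq_bigr => u _.
rewrite pull_odot !demazure_mulE mul_deltaE mul1r weyl_reflV.
by ring.
Qed.

Lemma evBl f g x : ev (f - g) x = ev f x - ev g x.
Proof.
rewrite !evE -sumrB; apply: eq_bigr => u _.
by rewrite pullD pullN !ffunE mulrBl.
Qed.

Lemma evBr f x y : ev f (x - y) = ev f x - ev f y.
Proof.
rewrite !evE -sumrB; apply: eq_bigr => u _.
by rewrite [(x - y) u]ffunE [(- y) u]ffunE mulrBr.
Qed.

Lemma ev1 f v : ev f (delta 1 (val v)) = f v.
Proof.
rewrite evE (bigD1 (val v)) //= deltaE eqxx mulr1 pull_val big1 ?addr0 //.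
by move=> u uv; rewrite deltaE (negPf uv) mulr0.
Qed.

(** A description of D_P^* without its pairing with D_P, on which the action of an
    endomorphism is immediate *)
Definition int_orbit f := forall x, inD x -> inSWPdual (odot x f).

Lemma int_orbit_odot x f : inD x -> int_orbit f -> int_orbit (odot x f).
Proof. by move=> xD h y yD; rewrite odotA; apply/h/inD_mul. Qed.

Lemma int_orbit_coord f v : int_orbit f -> inS (f v).
Proof.
by move=> /(_ _ (inD_delta Q 1%g) v); rewrite odot1.
Qed.

Lemma int_orbitB f g : int_orbit f -> int_orbit g -> int_orbit (f - g).
Proof.
by move=> hf hg x xD v; rewrite odotBr !ffunE; apply: inSB; [apply: hf | apply: hg].
Qed.

Lemma int_orbit_sum (I : Type) (r : seq I) (P : pred I) (F : I -> QWPdual) :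
  (forall i, P i -> int_orbit (F i)) -> int_orbit (\sum_(i <- r | P i) F i).
Proof.
move=> h; have h0 : int_orbit 0.
  move=> x xD v; rewrite -[0](subrr (0 : QWPdual)) odotBr subrr ffunE.
  exact: inS0.
apply: big_ind => // f g hf hg; rewrite -[g]opprK -[- g]sub0r.
by apply: int_orbitB => //; apply: int_orbitB.
Qed.

Lemma inDPdual_odot x f : inD x -> inDPdual f -> inDPdual (odot x f).
Proof.
have H f' : inDPdual f' <-> forall y, inD y -> inS (ev f' y).
  split=> [h y yD|h _ [y yD ->]]; last exact: h.
  by apply: h; exists y.
move=> xD; elim: xD f => {x} [s|i|x y _ IHx _ IHy|x y _ IHx _ IHy] f hf.
- apply/H => y yD; rewrite ev_scale; apply: inSM; first exact: inS_emb.
  exact: (H f).1.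
- apply/H => y yD; rewrite ev_demazure; apply: inSD.
    by apply: (H f).1 => //; apply: inD_mul => //; apply: inD_X.
  apply: inS_demazure; apply: (H f).1 => //; apply: inD_mul => //.
  exact: inD_delta.
- apply/H => z zD; rewrite odotBl evBl; apply: inSB.
    by apply: (H _).1 zD; apply: IHx.
  by apply: (H _).1 zD; apply: IHy.
- by rewrite -odotA; apply/IHx/IHy.
Qed.

Lemma int_orbit_ev x z : inD x -> (forall f, int_orbit f -> inS (ev f z)) ->
  forall f, int_orbit f -> inS (ev f (mulQW x z)).
Proof.
move=> xD; elim: xD z => {x} [s|i|x y _ IHx _ IHy|x y _ IHx _ IHy] z hz f hf.
- rewrite ev_delta qact1 invg1 odot1; apply: inSM; first exact: inS_emb.
  exact: hz.
- have -> : ev f (mulQW (X_ i) z) = ev (odot (X_ i) f) z -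
    (emb (xr i))^-1 * (ev f (mulQW (delta 1 (refl i)) z) -
                     qact (refl i) (ev f (mulQW (delta 1 (refl i)) z))).
    by rewrite ev_demazure addrK.
  apply: inSB; first by apply/hz/int_orbit_odot => //; apply: inD_X.
  apply: inS_demazure; rewrite ev_delta mul1r; apply/inS_qact/hz.
  by apply: int_orbit_odot => //; apply: inD_delta.
- by rewrite mulQWBl evBr; apply: inSB; [apply: IHx | apply: IHy].
- by rewrite -mulQWA; apply: IHx => //; apply: IHy.
Qed.

(** Evaluation at delta_v gives coordinates, and the rule ev_demazure moves an
    element of D from one side of the pairing to the other, up to terms that are
    integral. *)
Lemma inDPdualP f : inDPdual f <-> int_orbit f.
Proof.
split=> [h x xD v|h _ [x xD ->]].
  rewrite -ev1; apply: (inDPdual_odot xD h).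
  by exists (delta 1 (val v)) => //; apply: inD_delta.
rewrite -/(ev f x) -[x]mul_delta1r; apply: int_orbit_ev => // {h}f h.
by rewrite -(val_bar1 W J) ev1; apply: int_orbit_coord.
Qed.

(** * The class of a point *)

(** The identities proved in the symmetric algebra of the root lattice are transported
    to Q by this morphism, for all R at once. *)
Definition yval : {mpoly int[b_size B]} -> Q := fun p =>
  emb (map_mpoly intr p \mPo [tuple xr (al j) | j < b_size B]).

HB.instance Definition _ := GRing.RMorphism.copy yval
  (emb \o (comp_mpoly [tuple xr (al j) | j < b_size B] \o map_mpoly intr))%FUN.

Lemma yval_root i : yval (yroot B i) = emb (xr i).
Proof.
have yX j : yval 'X_j = emb (xr (al j)).
  by rewrite /yval map_mpolyX comp_mpolyXU -tnth_nth tnth_mktuple.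
rewrite /yroot raddf_sum /xroot {1}(coord_root B i) xchar_sum raddf_sum.
by apply: eq_bigr => j _; rewrite xcharMz !raddfMz /= yX.
Qed.

Lemma yval_root_unit i : yval (yroot B i) \is a GRing.unit.
Proof. by rewrite yval_root emb_root_unit. Qed.

Lemma mulQW_demazureE y i u : mulQW y (X_ i) u =
  (y u + y (u * refl i)%g) / emb (xr (wact u i)).
Proof.
have h q w : mulQW y (delta q w) u = y (u * w^-1)%g * qact (u * w^-1)%g q.
  rewrite mulQWE (bigD1 (u * w^-1)%g) //= invMg invgK mulgKV.
  rewrite deltaE eqxx big1 ?addr0 // => v vu; rewrite deltaE; case: eqP => [e|_].
    by case/eqP: vu; rewrite -e invMg invgK mulKVg.
  by rewrite rmorph0 mulr0.
rewrite mulQWDr mulQWNr !ffunE !h invg1 mulg1 weyl_reflV !rmorphV ?emb_root_unit //.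
rewrite /= !qact_root wactM -[wact (refl i) i]/(ropp W i) wact_opp.
rewrite /xroot root_opp -[- root _]sub0r xcharB.
have -> : xchar R (0 : 'cV_(rd_rank Phi)) = 0.
  by rewrite -[0](subrr 0) xcharB subrr.
by rewrite sub0r rmorphN invrN mulrN opprK mulrDl.
Qed.

Lemma xmonE l u :
  xmon W Q l u = yval (numer B l u) / yval (yall B) ^+ size l.
Proof.
elim: l u => [|g l IH] u /=; first by rewrite deltaE expr0 divr1 rmorph_nat; case: eqP.
rewrite mulQW_demazureE !IH -mulrDl -rmorphD rmorphM exprS.
have yu : yval (yall B) \is a GRing.unit.
  rewrite /yall rmorph_prod; apply: (big_ind (fun q : Q => q \is a GRing.unit)).
  - exact: unitr1.
  - by move=> a b au bu; rewrite unitrM au.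
  by move=> i _; apply: yval_root_unit.
rewrite -yval_root -!mulrA; congr (_ * _).
rewrite invrM ?unitrX // mulrCA; congr (_ * _).
move: yu; rewrite (ybutE B (wact u g)) rmorphM unitrM => /andP [y1 y2].
by rewrite invrM // mulrA mulrV // mul1r.
Qed.

Definition pt_coef : Q := \prod_(i in neg_roots B :\: levi_roots J) emb (xr i).

Lemma pt_coef_unit : pt_coef \is a GRing.unit.
Proof.
apply: (big_ind (fun q : Q => q \is a GRing.unit)); first exact: unitr1.
  by move=> a b au bu; rewrite unitrM au.
by move=> i _; apply: emb_root_unit.
Qed.

Lemma qact_pt_coef w : w \in WL -> qact w pt_coef = pt_coef.
Proof.
move=> wL; rewrite /pt_coef rmorph_prod /= [RHS](reindex_inj (@wact_inj _ _ w)) /=.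
apply: eq_big => [i|i _]; last by rewrite qact_root.
rewrite !in_setD -!/(levi J _) levi_wact // -!/(rneg B _).
by case: (boolP (levi J i)) => //= iL; rewrite (rneg_wact_levi wL).
Qed.

Local Notation pt := (pt_class W Q J).

Lemma pt_classE v : pt v = if v == bar 1%g then pt_coef else 0.
Proof. by rewrite ffunE. Qed.

Lemma bar_eq1 w : (bar w == bar 1%g) = (w \in WL).
Proof. by rewrite eq_sym bar_eq invg1 mul1g. Qed.

(** The translates by W reduce this to the coordinate at 1, where an element x of D
    gives pt_coef times the sum of its coefficients over W_P.  For a product of
    Demazure elements this is the image of a polynomial in the simple roots, by
    numer_levi_sum. *)
Lemma int_orbit_pt : int_orbit pt.
Proof.
have h1 x : inD x -> inS (odot x pt (bar 1%g)).
  move=> xD; rewrite odotE.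
  have -> : \sum_w x w * qact w (pt (bar (w^-1 * val (bar 1))%g)) =
            pt_coef * \sum_(w in WL) x w.
    rewrite mulr_sumr [RHS]big_mkcond; apply: eq_bigr => w _.
    rewrite val_bar1 mulg1 pt_classE bar_eq1 groupV.
    by case: ifP => wL; rewrite ?rmorph0 ?mulr0 // qact_pt_coef // mulrC.
  have [c ->] := inD_span xD.
  under eq_bigr => w _ do rewrite sum_ffunE.
  rewrite exchange_big mulr_sumr; apply: inS_sum => -[s l] _ /=.
  under eq_bigr => w _ do rewrite mul_deltaE qact1 invg1 mul1g xmonE.
  rewrite -mulr_sumr mulrCA; apply: inSM; first exact: inS_emb.
  rewrite -mulr_suml -rmorph_sum.
  have [q e] := @numer_levi_sum Phi B W J l.
  have -> : pt_coef = yval (\prod_(i in neg_roots B :\: levi_roots J) yroot B i).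
    by rewrite rmorph_prod /=; apply: eq_bigr => i _; rewrite yval_root.
  rewrite mulrA -rmorphM e rmorphM rmorphXn mulrK; last first.
    rewrite unitrX // /yall rmorph_prod.
    apply: (big_ind (fun q : Q => q \is a GRing.unit)); first exact: unitr1.
      by move=> a b au bu; rewrite unitrM au.
    by move=> i _; apply: yval_root_unit.
  exact: inS_emb.
move=> x xD v; rewrite -[odot x pt v](qactVK (val v)); apply: inS_qact.
have -> : qact (val v)^-1%g (odot x pt v) =
    odot (mulQW (delta 1 (val v)^-1%g) x) pt (bar 1%g).
  by rewrite -odotA odot_deltaE mul1r invgK val_bar1 mulg1 barK.
by apply/h1/inD_mul => //; apply: inD_delta.
Qed.

End DualModule.

(** * Leading coordinates *)

Section Leading.

Variables (R : comNzRingType) (Phi : root_datum) (B : base Phi).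
Variables (W : weyl_group Phi) (Q : root_localization R Phi).
Variable J : {set 'I_(b_size B)}.
Local Notation S := {mpoly R[rd_rank Phi]}.
Local Notation refl := (weyl_refl W).
Local Notation al := (@simple _ B).
Local Notation s_ j := (refl (al j)).
Local Notation rneg := (rneg B).
Local Notation len := (len B).
Local Notation wd := (word_elt (B := B) W).
Local Notation xr := (xroot R).
Local Notation emb := (emb Q).
Local Notation inS := (@inS R Phi Q).
Local Notation qact := (@Defs.qact R Phi W Q).
Local Notation WP := (WP W J).
Local Notation bar := (@bar _ B W J).
Local Notation QWPdual := (QWPdual W Q J).
Local Notation odot := (@odot R Phi B W Q J).
Local Notation inD := (@inD R Phi W Q).
Local Notation X_ i := (demazure W Q i).
Local Notation pt := (pt_class W Q J).
Local Notation pt_c := (pt_coef Q J).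
Implicit Types (f g : QWPdual) (v y : WP) (t : seq 'I_(b_size B)).

Definition xword t : QW W Q := \big[@mulQW R Phi W Q/delta 1 1%g]_(j <- t) X_ (al j).

Lemma xword_cons j t : xword (j :: t) = mulQW (X_ (al j)) (xword t).
Proof. by rewrite /xword big_cons. Qed.

Lemma inD_xword t : inD (xword t).
Proof.
elim: t => [|j t IH]; first by rewrite /xword big_nil; apply: inD_delta.
by rewrite xword_cons; apply: inD_mul => //; apply: inD_X.
Qed.

(** This is the coefficient of delta_w in X_(j_1) ... X_(j_l), for a reduced
    expression s_(j_1) ... s_(j_l) of w: delta_w only arises from the terms in
    delta_(s_j) of the factors, all other choices of terms give shorter elements. *)
Fixpoint top_coef t : Q := if t is j :: t' then
  - ((emb (xr (al j)))^-1 * qact (s_ j) (top_coef t')) else 1.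

Lemma top_coef_unit t : top_coef t \is a GRing.unit.
Proof.
elim: t => [|j t IH] /=; first exact: unitr1.
by rewrite unitrN unitrM unitrV emb_root_unit rmorph_unit.
Qed.

Lemma top_coef_cat t t' : top_coef (t ++ t') = top_coef t * qact (wd t) (top_coef t').
Proof.
elim: t => [|j t IH] /=; first by rewrite word_nil qact1 mul1r.
by rewrite IH rmorphM /= qactM word_cons mulrA mulNr.
Qed.

Definition supp_le f k := forall v, (k < len (val v))%N -> f v = 0.

(** A letter raises the length of the support by at most 1, and only its term in
    delta_(s_j) raises it. *)
Lemma odot_xword_lead t f k y : supp_le f k ->
  (k + size t <= len (val y))%N ->
  odot (xword t) f y = top_coef t * qact (wd t) (f (bar ((wd t)^-1 * val y)%g)).
Proof.
move=> fk; elim: t y => [|j t IH] y h.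
  by rewrite /xword big_nil odot1 word_nil qact1 invg1 mul1g barK mul1r.
have h0 : (k + size t < len (val y))%N by rewrite -addnS.
rewrite xword_cons -odotA odot_demazureE IH ?(ltnW h0) //.
have -> : f (bar ((wd t)^-1 * val y)%g) = 0.
  apply: fk; have := len_bar_mul J (wd t)^-1%g (val y).
  rewrite barK len_inv => h1; rewrite -(ltn_add2r (size t)).
  apply: (leq_trans h0); apply: (leq_trans h1).
  by rewrite addnC leq_add2l len_word.
rewrite rmorph0 mulr0 sub0r IH; last first.
  have := len_bar_mul J (s_ j) (val y); rewrite barK => h1.
  rewrite -ltnS; apply: (leq_trans h0); apply: (leq_trans h1).
  rewrite -add1n leq_add2r; have := len_word W [:: j].
  by rewrite word_cons word_nil mulg1.
rewrite rmorphM /= qactM bar_mull word_cons invMg weyl_reflV mulgA.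
by rewrite mulrN mulNr mulrA.
Qed.

(** Each letter contributes the inverse of a root, and these are the roots that the
    inverse of the word makes negative. *)
Lemma top_coef_reduced t : size t = len (wd t) ->
  top_coef t * \prod_(i | rneg i && ~~ rneg (wact (wd t) i)) emb (xr (wact (wd t) i))
  = (-1) ^+ size t.
Proof.
elim: t => [|j t IH] h.
  rewrite word_nil /= big1 ?mulr1 // => i; rewrite wact1.
  by case: (rneg i).
have [ht hpos] := reduced_cons h; rewrite word_cons.
set w := wd t in ht hpos *; set i0 := wact w^-1%g (ropp W (al j)).
have wi0 : wact w i0 = ropp W (al j) by rewrite /i0 wactVK.
have si0 : wact (s_ j * w)%g i0 = al j.
  by rewrite wactM wi0 wact_opp -/(ropp W _) roppK.
rewrite (bigD1 i0) /=; last first.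
  by rewrite si0 rneg_simple /i0 wact_opp (rneg_opp _ W) hpos.
have <- : - qact (s_ j) ((-1) ^+ size t) = (-1) ^+ (size t).+1.
  by rewrite rmorphXn rmorphN rmorph1 exprS mulN1r.
rewrite si0 -(IH ht) mulNr rmorphM rmorph_prod /= mulrACA mulVr ?emb_root_unit //.
rewrite mul1r; congr (- (_ * _)).
apply: eq_big => [i|i _]; last by rewrite qact_root wactM.
case: (eqVneq i i0) => [->|ni] /=.
  by rewrite wi0 andbF (rneg_opp _ W) rneg_simple andbF.
have n1 : wact w i != ropp W (al j) by rewrite -wi0 (inj_eq (@wact_inj _ _ w)).
case: (eqVneq (wact w i) (al j)) => [e|n2].
  have -> : i = wact w^-1%g (al j) by rewrite -e wactK.
  by rewrite hpos.
by rewrite andbT wactM rneg_refl_simple.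
Qed.

Lemma top_coef_longest (w : WP) t :
  (forall i, rneg (wact (val w) i) = (if levi J i then rneg i else ~~ rneg i)) ->
  wd t = val w -> size t = len (val w) ->
  top_coef t * qact (val w) pt_c = (-1) ^+ size t.
Proof.
move=> h tw st; rewrite -top_coef_reduced ?tw // /pt_coef rmorph_prod /=.
congr (_ * _); apply: eq_big => [i|i _]; last by rewrite qact_root.
rewrite in_setD -/(levi J i) -/(rneg i) h.
by case: (levi J i); case: (rneg i).
Qed.

Lemma supp_le_pt : supp_le pt 0.
Proof.
move=> v; rewrite pt_classE; case: eqP => // ->.
by rewrite val_bar1 len1.
Qed.

Lemma odot_xword_pt t y : (size t <= len (val y))%N ->
  odot (xword t) pt y =
  if bar (wd t) == y then top_coef t * qact (wd t) pt_c else 0.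
Proof.
move=> h; rewrite (odot_xword_lead supp_le_pt) // pt_classE bar_eq.
rewrite mulg1 -groupV invgK -bar_eq barK.
by case: eqP => // _; rewrite rmorph0 mulr0.
Qed.

(** Both sides can be compared at the longest element w of W^P: a word t' for
    w v^-1 moves the coordinates of f and of the Schubert class from v to w, with
    the same twisted multiplication, and at w the Schubert class of t' ++ t has
    coordinate +-1. *)
Lemma lead_divisible f v t : int_orbit f -> supp_le f (len (val v)) ->
  wd t = val v -> size t = len (val v) ->
  exists a : S, f v = emb a * odot (xword t) pt v.
Proof.
move=> fD fv tv st.
(* x carries v to the longest element w of W^P *)
have [w h] := longest_rep W J.
set x := (val w * (val v)^-1)%g.
have [t' t'x st'] := len_reduced B x.
have lenw := len_longest v h; rewrite -/x -st' -st in lenw.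
have := fD _ (inD_xword t') w; rewrite (odot_xword_lead fv); last first.
  by rewrite -st addnC lenw.
have -> : bar ((wd t')^-1 * val w)%g = v.
  by rewrite t'x /x invMg invgK mulgKV barK.
rewrite t'x => h1.
have := @top_coef_longest w (t' ++ t) h; rewrite word_cat t'x tv mulgKV size_cat.
move=> /(_ erefl lenw); rewrite top_coef_cat t'x => h2.
have Lv : odot (xword t) pt v = top_coef t * qact (val v) pt_c.
  by rewrite odot_xword_pt ?st // tv barK eqxx.
have h3 : top_coef t' * qact x (odot (xword t) pt v) = (-1) ^+ (size t' + size t).
  by rewrite -h2 Lv rmorphM /= qactM mulgKV mulrA.
have [a ea] : inS (qact x^-1%g
    ((-1) ^+ (size t' + size t) * (top_coef t' * qact x (f v)))).
  apply/inS_qact/inSM => //; rewrite -signr_odd.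
  by case: odd; [apply/inSN/inS1 | apply: inS1].
exists a; rewrite -ea; apply: (can_inj (qactK x)).
rewrite rmorphM /= qactVK; set e := (-1) ^+ _ in h3 *.
transitivity (e * (top_coef t' * qact x (odot (xword t) pt v)) * qact x (f v)).
  by rewrite h3 -expr2 sqrr_sign mul1r.
by ring.
Qed.

(** * Degrees *)

(** Fractions can have negative degrees; with 0 as the only polynomial of negative
    degree, degrees add up in products for all integers. *)
Definition zhomog (z : int) (p : S) : Prop :=
  if z is Posz d then p \is d.-homog else p = 0.

Lemma zhomog0 z : zhomog z 0.
Proof. by case: z => //= d; apply: rpred0. Qed.

Lemma zhomogD z p q : zhomog z p -> zhomog z q -> zhomog z (p + q).
Proof. by case: z => [d|d] /=; [apply: rpredD | move=> -> ->; rewrite addr0]. Qed.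

Lemma zhomogN z p : zhomog z p -> zhomog z (- p).
Proof. by case: z => [d|d] /=; [rewrite rpredN | move=> ->; rewrite oppr0]. Qed.

Lemma zhomogM z1 z2 p q : zhomog z1 p -> zhomog z2 q -> zhomog (z1 + z2) (p * q).
Proof.
case: z1 => [d1|d1] hp; last first.
  by have -> : p = 0 := hp; rewrite mul0r => _; apply: zhomog0.
case: z2 => [d2|d2] hq; last first.
  by have -> : q = 0 := hq; rewrite mulr0; apply: zhomog0.
exact: dhomogM.
Qed.

Lemma zhomog_xprod m : zhomog (Posz (size m)) (xprod R m).
Proof.
elim: m => [|i m IH]; rewrite /xprod ?big_nil ?big_cons; first exact: dhomog1.
rewrite /= -add1n; apply: dhomogM IH.
apply: rpred_sum => j _; rewrite -scaler_int; apply: dhomogZ.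
by rewrite dhomogX /= mdeg1.
Qed.

Definition hfrac (k : int) (q : Q) := exists p m,
  zhomog (k + Posz (size m)) p /\ q = emb p / emb (xprod R m).

Lemma hfrac0 k : hfrac k 0.
Proof.
by exists 0, [::]; split; [apply: zhomog0 | rewrite rmorph0 mul0r].
Qed.

Lemma hfracD k q1 q2 : hfrac k q1 -> hfrac k q2 -> hfrac k (q1 + q2).
Proof.
case=> p1 [m1 [h1 ->]] [p2 [m2 [h2 ->]]].
exists (p1 * xprod R m2 + p2 * xprod R m1), (m1 ++ m2); split.
  rewrite size_cat PoszD; apply: zhomogD.
    by rewrite addrA; apply: zhomogM (zhomog_xprod m2).
  by rewrite [Posz _ + _]addrC addrA; apply: zhomogM (zhomog_xprod m1).
have -> : xprod R (m1 ++ m2) = xprod R m1 * xprod R m2 by rewrite /xprod big_cat.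
rewrite rmorphD !rmorphM mulrDl; congr (_ + _); apply/eqP.
  rewrite frac_eq ?unitrM ?emb_xprod_unit //; by rewrite mulrAC mulrA.
by rewrite frac_eq ?unitrM ?emb_xprod_unit // mulrA mulrAC.
Qed.

Lemma hfracN k q : hfrac k q -> hfrac k (- q).
Proof.
case=> p [m [h ->]]; exists (- p), m; split; first exact: zhomogN.
by rewrite rmorphN mulNr.
Qed.

Lemma hfracM k1 k2 q1 q2 : hfrac k1 q1 -> hfrac k2 q2 -> hfrac (k1 + k2) (q1 * q2).
Proof.
case=> p1 [m1 [h1 ->]] [p2 [m2 [h2 ->]]].
exists (p1 * p2), (m1 ++ m2); split.
  by rewrite size_cat PoszD addrACA; apply: zhomogM.
have -> : xprod R (m1 ++ m2) = xprod R m1 * xprod R m2 by rewrite /xprod big_cat.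
by rewrite !rmorphM invrM ?emb_xprod_unit // [X in _ = _ * X]mulrC mulrACA.
Qed.

Lemma hfrac_sum k (I : Type) (r : seq I) (P : pred I) (F : I -> Q) :
  (forall i, P i -> hfrac k (F i)) -> hfrac k (\sum_(i <- r | P i) F i).
Proof. by move=> h; apply: big_ind => //; [apply: hfrac0 | apply: hfracD]. Qed.

Lemma hfrac_emb z s : zhomog z s -> hfrac z (emb s).
Proof.
move=> h; exists s, [::]; rewrite addr0; split=> //.
by rewrite /xprod big_nil rmorph1 divr1.
Qed.

Lemma hfrac1 : hfrac 0 1.
Proof. by rewrite -(rmorph1 emb); apply/hfrac_emb/dhomog1. Qed.

Lemma hfrac_root i : hfrac 1 (emb (xr i)).
Proof.
apply: hfrac_emb; have := zhomog_xprod [:: i].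
by rewrite /xprod big_seq1.
Qed.

Lemma hfrac_rootV i : hfrac (-1) (emb (xr i))^-1.
Proof.
exists 1, [:: i]; split; first exact: dhomog1.
by rewrite rmorph1 mul1r /xprod big_seq1.
Qed.

Lemma zhomog_sact z (w : W) s : zhomog z s -> zhomog z (sact w s).
Proof.
case: z => [d|d]; last by move=> ->; rewrite rmorph0.
move=> h; rewrite -[s in sact w s](pihomog_dE h) pihomogE raddf_sum /=.
apply: rpred_sum => m /eqP md.
rewrite -[sact w _]/(_ \mPo _) comp_mpolyZ; apply: dhomogZ; rewrite comp_mpolyX.
rewrite -[d]md mdegE.
apply: (big_rec2 (fun k (p : S) => p \is k.-homog)) => [|i k p _ hp].
  exact: dhomog1.
apply: dhomogM hp; rewrite -[X in X.-homog]mul1n; apply: dhomogMn.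
rewrite tnth_mktuple; apply: rpred_sum => j _; rewrite -scaler_int; apply: dhomogZ.
by rewrite dhomogX /= mdeg1.
Qed.

Lemma hfrac_qact k (w : W) q : hfrac k q -> hfrac k (qact w q).
Proof.
case=> p [m [h ->]]; rewrite qact_frac; exists (sact w p), (map (wact w) m).
by rewrite size_map; split=> //; apply: zhomog_sact.
Qed.

Hypothesis two_regular : forall x : R, 2 * x = 0 -> x = 0.

Lemma xprod_regular m (p : S) : p * xprod R m = 0 -> p = 0.
Proof.
elim: m p => [|i m IH] p; rewrite /xprod ?big_nil ?big_cons ?mulr1 //.
by rewrite mulrA => /IH; apply: xroot_regular.
Qed.

Lemma emb_inj s s' : emb s = emb s' -> s = s'.
Proof.
move=> e; apply/eqP; rewrite -subr_eq0; apply/eqP.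
have h : emb (s - s') = 0 by rewrite rmorphB e subrr.
by have [m] := emb_eq0 h; apply: xprod_regular.
Qed.

(** Multiplication by a regular homogeneous x is injective on the components. *)
Lemma zhomog_div z k s x : zhomog (z + Posz k) (s * x) -> x \is k.-homog ->
  (forall p : S, p * x = 0 -> p = 0) -> zhomog z s.
Proof.
move=> hsx hx xreg.
have pi e : pihomog mdeg (e + k) (s * x) = pihomog mdeg e s * x.
  have {1}-> := pihomog_partitionE (leqnn (mmeasure mdeg s)).
  rewrite mulr_suml raddf_sum /=.
  rewrite (eq_bigr (fun d : 'I_ _ =>
      if (d : nat) == e then pihomog mdeg e s * x else 0)) => [|d _]; last first.
    have hd := dhomogM (pihomogP mdeg d s) hx.
    case: eqP => [de|/eqP de]; first by rewrite -de (pihomog_dE hd).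
    by rewrite (pihomog_ne0 _ hd) // eqn_add2r.
  have [el|le] := ltnP e (mmeasure mdeg s).
    rewrite (bigD1 (Ordinal el)) //= eqxx big1 ?addr0 // => d de.
    by case: eqP => // ed; case/eqP: de; apply: val_inj.
  rewrite big1 => [|d _]; last by rewrite ltn_eqF // (leq_trans (ltn_ord d)).
  suff -> : pihomog mdeg e s = 0 by rewrite mul0r.
  rewrite [s](pihomog_partitionE (leqnn (mmeasure mdeg s))) raddf_sum big1 // => d _.
  rewrite /=; apply: pihomog_ne0 (pihomogP mdeg d s).
  by rewrite ltn_eqF // (leq_trans (ltn_ord d)).
have h e : Posz e != z -> pihomog mdeg e s = 0.
  move=> ez; apply: xreg; rewrite -pi.
  move: hsx; case ed: (z + Posz k) => [d|d] /=; last first.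
    by move=> ->; rewrite pihomog0.
  move=> hd; apply: pihomog_ne0 hd; apply: contraNneq ez => dek.
  by apply/eqP; apply: (addIr (Posz k)); rewrite ed dek.
have es := pihomog_partitionE (leqnn (mmeasure mdeg s)).
case: z {hsx} h => [d|d] h /=; rewrite es.
  apply: rpred_sum => e _; case: (eqVneq (e : nat) d) => [<-|ne].
    exact: pihomogP.
  by rewrite h ?rpred0.
by rewrite big1 // => e _; apply: h.
Qed.

Lemma zhomog_hfrac z s : hfrac z (emb s) -> zhomog z s.
Proof.
case=> p [m [h e]]; have hm := zhomog_xprod m.
apply: (zhomog_div _ hm); last exact: xprod_regular.
suff -> : s * xprod R m = p by [].
by apply: emb_inj; rewrite rmorphM e divrK // emb_xprod_unit.
Qed.

(** * Expansion in Schubert classes *)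

Lemma hfrac_prodV (I : Type) (r : seq I) (P : pred I) (F : I -> rd_ix Phi) :
  hfrac (- (Posz (count P r))) (\prod_(i <- r | P i) emb (xr (F i)))^-1.
Proof.
elim: r => [|i r IH]; rewrite ?big_nil ?big_cons /=; first by rewrite invr1; apply: hfrac1.
case: (P i); last exact: IH.
rewrite invrM ?emb_root_unit //; last first.
  apply: (big_ind (fun q : Q => q \is a GRing.unit)); first exact: unitr1.
    by move=> a b au bu; rewrite unitrM au.
  by move=> k _; apply: emb_root_unit.
have -> : - Posz (1 + count P r) = - Posz (count P r) + -1 by lia.
exact: hfracM IH (hfrac_rootV _).
Qed.

Lemma hfrac_prod (I : Type) (r : seq I) (P : pred I) (F : I -> rd_ix Phi) :
  hfrac (Posz (count P r)) (\prod_(i <- r | P i) emb (xr (F i))).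
Proof.
elim: r => [|i r IH]; rewrite ?big_nil ?big_cons /=; first exact: hfrac1.
case: (P i); last exact: IH.
have -> : Posz (1 + count P r) = 1 + Posz (count P r) by lia.
exact: hfracM (hfrac_root _) IH.
Qed.

Definition dim_flag : nat := #|neg_roots B :\: levi_roots J|.

Lemma hfrac_pt_coef : hfrac (Posz dim_flag) pt_c.
Proof.
rewrite /dim_flag cardE /pt_coef -big_enum /=.
rewrite -(@count_predT _ (enum _)); exact: hfrac_prod.
Qed.

Lemma hfrac_pt_coefV : hfrac (- Posz dim_flag) pt_c^-1.
Proof.
rewrite /dim_flag cardE /pt_coef -big_enum /=.
rewrite -(@count_predT _ (enum _)); exact: hfrac_prodV.
Qed.

Lemma hfrac_top_coefV t : hfrac (Posz (size t)) (top_coef t)^-1.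
Proof.
elim: t => [|j t IH] /=; first by rewrite invr1; apply: hfrac1.
rewrite invrN; apply: hfracN; rewrite invrM ?unitrV ?emb_root_unit //; last first.
  by rewrite rmorph_unit // top_coef_unit.
rewrite invrK -rmorphV ?top_coef_unit //.
have -> : Posz (size t).+1 = Posz (size t) + 1 by lia.
by apply: hfracM (hfrac_root _); apply: hfrac_qact.
Qed.

Lemma hfrac_xword_pt t u : hfrac (Posz dim_flag - Posz (size t)) (odot (xword t) pt u).
Proof.
elim: t u => [|j t IH] u.
  rewrite /xword big_nil odot1 subr0 pt_classE.
  by case: eqP => _; [apply: hfrac_pt_coef | apply: hfrac0].
rewrite xword_cons -odotA odot_demazureE.
have -> : Posz dim_flag - Posz (size (j :: t)) = -1 + (Posz dim_flag - Posz (size t)).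
  by rewrite /=; lia.
apply: hfracM (hfrac_rootV _) _; apply: hfracD => //; apply: hfracN.
exact: hfrac_qact.
Qed.

(** The coordinates of maximal length of f are multiples of those of the Schubert
    classes; subtracting these multiples lowers the lengths in the support. *)
Lemma schubert_expand (rw : WP -> seq 'I_(b_size B)) f (m : int) :
  (forall v, wd (rw v) = val v /\ size (rw v) = len (val v)) ->
  int_orbit f -> (forall u, hfrac m (f u)) ->
  exists a : WP -> S,
    f = \sum_v [ffun u => emb (a v) * odot (xword (rw v)) pt u] /\
    forall v, zhomog (m - Posz dim_flag + Posz (len (val v))) (a v).
Proof.
move=> rwP.
pose xi v := odot (xword (rw v)) pt.
have xiE v y : (len (val v) <= len (val y))%N ->
    xi v y = if v == y then xi v y else 0.
  have [e1 e2] := rwP v; rewrite -e2 => h; rewrite /xi odot_xword_pt // e1 barK.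
  by case: eqP.
have [k] : exists k, forall v, (k <= len (val v))%N -> f v = 0.
  by exists #|rd_ix Phi|.+1 => v; rewrite (len_ninv B) ltnNge ninv_le.
elim: k f => [|k IH] f fk fD fh.
  exists (fun=> 0); split; last by move=> v; apply: zhomog0.
  rewrite big1 => [|v _]; last by apply/ffunP => u; rewrite !ffunE rmorph0 mul0r.
  by apply/ffunP => v; rewrite fk // ffunE.
have /fin_all_exists [a aP] (v : {w : W | min_rep J w}) : exists a : S,
    [/\ len (val v) = k -> f v = emb a * xi v v,
        len (val v) <> k -> a = 0 &
        zhomog (m - Posz dim_flag + Posz (len (val v))) a].
  case: (eqVneq (len (val v)) k) => [ek|/eqP nk]; last first.
    by exists 0; split=> //; apply: zhomog0.
  have [tv sv] := rwP v.
  have [a ea] : exists a, f v = emb a * xi v v.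
    by apply: lead_divisible tv sv => // u; rewrite ek => /fk.
  exists a; split=> //; apply: zhomog_hfrac.
  have xv : xi v v = top_coef (rw v) * qact (val v) pt_c.
    by rewrite /xi odot_xword_pt ?sv // tv barK eqxx.
  have -> : emb a = f v * (qact (val v) pt_c^-1 * (top_coef (rw v))^-1).
    have uq : qact (val v) pt_c \is a GRing.unit.
      by rewrite rmorph_unit // pt_coef_unit.
    rewrite rmorphV ?pt_coef_unit // -invrM ?top_coef_unit //.
    by rewrite ea xv mulrK // unitrM top_coef_unit.
  rewrite -addrA; apply: hfracM => //; rewrite -sv; apply: hfracM; last exact: hfrac_top_coefV.
  exact/hfrac_qact/hfrac_pt_coefV.
(* In length k only xi_y has a coordinate at y, so the coordinates of g of length
   at least k vanish. *)
pose g := f - \sum_v [ffun u => emb (a v) * xi v u].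
have gE y : g y = f y - \sum_v emb (a v) * xi v y.
  by rewrite !ffunE sum_ffunE; congr (_ - _); apply: eq_bigr => v _; rewrite ffunE.
have [||| b [gb bh]] := IH g.
- move=> y ky; rewrite gE; have [kl|lk] := ltnP k (len (val y)).
    rewrite fk // sub0r big1 ?oppr0 // => v _.
    have [_ av _] := aP v; case: (eqVneq (len (val v)) k) => [e|/eqP /av ->].
      rewrite xiE ?e //; case: eqP => [vy|_]; last by rewrite mulr0.
      by rewrite -vy e ltnn in kl.
    by rewrite rmorph0 mul0r.
  have ey : len (val y) = k by apply/eqP; rewrite eqn_leq lk ky.
  rewrite (bigD1 y) //= big1 ?addr0 => [|v vy].
    by have [-> // _ _] := aP y; rewrite subrr.
  have [_ av _] := aP v; case: (eqVneq (len (val v)) k) => [e|/eqP /av ->].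
    by rewrite xiE ?e ?ey // (negPf vy) mulr0.
  by rewrite rmorph0 mul0r.
- apply: int_orbitB => //; apply: int_orbit_sum => v _.
  have -> : [ffun u => emb (a v) * xi v u] = odot (delta (emb (a v)) 1%g) (xi v).
    by apply/ffunP => u; rewrite ffunE odot_scaleE.
  apply: int_orbit_odot; first exact: inD_S.
  apply: int_orbit_odot; [exact: inD_xword | exact: int_orbit_pt].
- move=> u; rewrite gE; apply: hfracD => //; apply: hfracN.
  apply: hfrac_sum => v _; have [_ _ av] := aP v; have [_ sv] := rwP v.
  have -> : m = m - Posz dim_flag + Posz (len (val v)) + (Posz dim_flag - Posz (size (rw v))).
    by rewrite sv; ring.
  by apply: hfracM (hfrac_xword_pt _ _); apply: hfrac_emb.
exists (fun v => a v + b v); split=> [|v]; last first.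
  by have [_ _ av] := aP v; apply: zhomogD.
rewrite -[f](subrK (\sum_v [ffun u => emb (a v) * xi v u])) -/g gb -big_split /=.
apply: eq_bigr => v _; apply/ffunP => u; rewrite !ffunE rmorphD mulrDl addrC.
by [].
Qed.

End Leading.

(** * Comparison of the endomorphism rings *)

Section Endomorphisms.

Variables (R : comNzRingType) (Phi : root_datum) (B : base Phi).
Variables (W : weyl_group Phi) (Q : root_localization R Phi).
Variable J : {set 'I_(b_size B)}.
Local Notation S := {mpoly R[rd_rank Phi]}.
Local Notation refl := (weyl_refl W).
Local Notation len := (len B).
Local Notation emb := (emb Q).
Local Notation inS := (@inS R Phi Q).
Local Notation qact := (@Defs.qact R Phi W Q).
Local Notation WL := (weyl_levi W J).
Local Notation WP := (WP W J).
Local Notation bar := (@bar _ B W J).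
Local Notation QWPdual := (QWPdual W Q J).
Local Notation odot := (@odot R Phi B W Q J).
Local Notation permact := (@permact R Phi B W J).
Local Notation inD := (@inD R Phi W Q).
Local Notation RWP := (RWP R W J).
Local Notation RWP_emb := (@RWP_emb R Phi B W Q J).
Local Notation pt := (pt_class W Q J).
Local Notation pt_c := (pt_coef Q J).
Local Notation schubert := (@schubert R Phi B W Q J).
Implicit Types (f : RWP) (F G : QWPdual) (phi : QWPdual -> QWPdual).

Definition xconst (x : {ffun W -> R}) : QW W Q := [ffun w => emb (x w)%:MP].

Lemma permactE x f v :
  permact x f v = \sum_w x w * f (bar (w^-1 * val v)%g).
Proof.
rewrite /Defs.permact sum_ffunE; apply: eq_bigr => w _; rewrite sum_ffunE.
rewrite (bigD1 (bar (w^-1 * val v)%g)) //= ffunE bar_mull mulKVg barK eqxx.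
rewrite big1 ?addr0 // => u uv; rewrite ffunE; case: eqP => // e; case/eqP: uv.
by rewrite e bar_mull mulKg barK.
Qed.

Lemma RWP_embE f v : RWP_emb f v = emb (f v)%:MP.
Proof. by rewrite ffunE. Qed.

Lemma qact_const (w : W) c : qact w (emb c%:MP) = emb c%:MP.
Proof. by rewrite qact_emb /sact comp_mpolyC. Qed.

Lemma RWP_emb_permact x f : RWP_emb (permact x f) = odot (xconst x) (RWP_emb f).
Proof.
apply/ffunP => v; rewrite RWP_embE permactE odotE !raddf_sum /=.
by apply: eq_bigr => w _; rewrite !ffunE qact_const !rmorphM.
Qed.

Lemma RWP_embD f1 f2 : RWP_emb (f1 + f2) = RWP_emb f1 + RWP_emb f2.
Proof. by apply/ffunP => v; rewrite !ffunE !rmorphD. Qed.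

Lemma hfrac_const c : hfrac 0 (emb c%:MP).
Proof.
apply: (@hfrac_emb R Phi Q 0); rewrite -alg_mpolyC.
by apply: dhomogZ; apply: dhomog1.
Qed.

Definition RWP1 : RWP := [ffun v => (v == bar 1%g)%:R].

Local Notation fone := (RWP_emb RWP1).

Lemma foneE v : fone v = if v == bar 1%g then 1 else 0.
Proof. by rewrite !ffunE; case: eqP; rewrite ?rmorph1 ?rmorph0. Qed.

(** With values in Q, this is a representative in Q_W of the element of the cyclic
    module generated by f_1; see odot_lift1. *)
Definition lift (A : zmodType) (f : {ffun WP -> A}) : {ffun W -> A} :=
  [ffun w => if val (bar w) == w then f (bar w) else 0].

Lemma sum_lift (A : zmodType) (f : {ffun WP -> A}) (F : W -> A -> Q) :
  (forall w, F w 0 = 0) ->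
  \sum_w F w (lift f w) = \sum_v F (val v) (f v).
Proof.
move=> F0; rewrite (bigID (fun w => val (bar w) == w)) /=.
rewrite [X in _ + X]big1 => [|w /negPf nw]; last by rewrite ffunE nw F0.
rewrite addr0 (reindex_onto val bar) => [|w /eqP //].
have hv v : bar_val J (val v) = val v := congr1 val (barK v).
by apply: eq_big => [v|v _]; rewrite ?ffunE /= hv barK !eqxx.
Qed.

Lemma odot_liftE F G y : odot (lift F) G y =
  \sum_v F v * qact (val v) (G (bar ((val v)^-1 * val y)%g)).
Proof.
rewrite odotE.
apply: (@sum_lift _ F (fun w q => q * qact w (G (bar (w^-1 * val y)%g)))) => w.
by rewrite mul0r.
Qed.

Lemma odot_lift1 F : odot (lift F) fone = F.
Proof.
apply/ffunP => y; rewrite odot_liftE (bigD1 y) //= mulVg foneE eqxx rmorph1.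
rewrite mulr1 big1 ?addr0 // => v vy; rewrite foneE bar_eq mulg1 -groupV invgK.
by rewrite -bar_eq !barK (negPf vy) rmorph0 mulr0.
Qed.

Lemma xconst_lift f : xconst (lift f) = lift (RWP_emb f).
Proof. by apply/ffunP => w; rewrite !ffunE; case: ifP; rewrite ?ffunE ?rmorph0. Qed.

Lemma RWP_emb_permact_lift f r :
  RWP_emb (permact (lift f) r) = odot (lift (RWP_emb f)) (RWP_emb r).
Proof. by rewrite RWP_emb_permact xconst_lift. Qed.

Lemma E_Q_fone phi F : E_Q phi -> phi F = odot (lift F) (phi fone).
Proof. by case=> _ [_ h]; rewrite -h ?odot_lift1. Qed.

Lemma E_Q_odot phi x F : E_Q phi -> phi (odot x F) = odot x (phi F).
Proof. by case=> _ [_ h]; apply: h. Qed.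

Lemma E_RW_fone phi : E_RW phi -> exists r, phi fone = RWP_emb r.
Proof. by case=> _ [psi [_ h]]; exists (psi RWP1). Qed.

(** Over S, as over Q, an endomorphism is determined by its value at f_1. *)
Lemma E_S_of phi : E_Q phi -> inSWPdual (phi fone) -> E_S phi.
Proof.
move=> hQ h1; split=> //; case: (hQ) => _ [hD hx]; split; last first.
  by split=> [f g _ _|x f _ _]; [apply: hD | apply: hx].
move=> F hF v; rewrite (E_Q_fone F hQ) odot_liftE; apply: inS_sum => w _.
by apply: inSM; [apply: hF | apply/inS_qact/h1].
Qed.

(** An endomorphism that preserves integral coordinates preserves integral orbits,
    since it commutes with D. *)
Lemma E_S_sub_E_D phi : E_S phi -> E_D phi.
Proof.
case=> hQ [hS _]; split=> //; case: (hQ) => _ [hD hx]; split; last first.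
  by split=> [f g _ _|x f _ _]; [apply: hD | apply: hx].
move=> F /inDPdualP hF; apply/inDPdualP => x xD.
by rewrite -E_Q_odot //; apply/hS/hF.
Qed.

Lemma E_RW_sub_E_S phi : E_RW phi -> E_S phi.
Proof.
move=> h; apply: E_S_of; first by case: h.
by have [r ->] := E_RW_fone h => v; rewrite RWP_embE; apply: inS_emb.
Qed.

Lemma pt_fone : pt = odot (delta pt_c 1%g) fone.
Proof.
apply/ffunP => v; rewrite odot_scaleE foneE pt_classE.
by case: eqP; rewrite ?mulr1 ?mulr0.
Qed.

Hypothesis two_regular : forall x : R, 2 * x = 0 -> x = 0.

Lemma RWP_emb_inj f1 f2 : RWP_emb f1 = RWP_emb f2 -> f1 = f2.
Proof.
move=> e; apply/ffunP => v; have := congr1 (fun F : QWPdual => F v) e.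
rewrite !RWP_embE => /(emb_inj two_regular) /(congr1 (fun p : S => p@_0%MM)).
by rewrite !mcoeffC eqxx !mulr1.
Qed.

(** The values on R[W/W_P] are combinations over R of the translates of phi(f_1). *)
Lemma E_RW_of phi r : E_Q phi -> phi fone = RWP_emb r -> E_RW phi.
Proof.
move=> hQ hr; split=> //; exists (fun f => permact (lift f) r).
have h f : phi (RWP_emb f) = RWP_emb (permact (lift f) r).
  by rewrite (E_Q_fone _ hQ) hr RWP_emb_permact_lift.
split=> //; split=> //; case: (hQ) => _ [hD hx]; split=> [f g _ _|x f _ _].
  by apply: RWP_emb_inj; rewrite RWP_embD -!h RWP_embD hD.
by apply: RWP_emb_inj; rewrite -h [in LHS]RWP_emb_permact hx // h -RWP_emb_permact.
Qed.

Lemma permactD x f1 f2 : permact x (f1 + f2) = permact x f1 + permact x f2.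
Proof.
by apply: RWP_emb_inj; rewrite RWP_embD !RWP_emb_permact RWP_embD odotDr.
Qed.

Lemma permact_lift1 f : permact (lift f) RWP1 = f.
Proof. by apply: RWP_emb_inj; rewrite RWP_emb_permact_lift odot_lift1. Qed.

(** An endomorphism defined over R preserves the degrees of coordinates. *)
Lemma E_RW_sub_E_D0 rw phi :
  (forall w : WP, reduced_word (rw w) (val w)) -> E_RW phi -> E_D0 rw phi.
Proof.
move=> rwP h; split; first exact/E_S_sub_E_D/E_RW_sub_E_S.
have [_ [hD _]] := E_S_sub_E_D (E_RW_sub_E_S h).
have [r hr] := E_RW_fone h.
have hexp w := schubert_expand two_regular (rw := rw)
  (f := phi (schubert (rw w))) (m := Posz (dim_flag J) - Posz (size (rw w))) rwP.
have /fin_all_exists [a aP] (w : {w : W | min_rep J w}) : exists a : WP -> S,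
   phi (schubert (rw w)) = \sum_v [ffun u => emb (a v) * schubert (rw v) u] /\
   forall v, zhomog (Posz (len (val v)) - Posz (len (val w))) (a v).
  have [||a [ha1 ha2]] := hexp w.
  - apply/inDPdualP/hD/inDPdualP/int_orbit_odot; first exact: inD_xword.
    exact: int_orbit_pt.
  - move=> u; rewrite (E_Q_fone _ h.1) hr odot_liftE; apply: hfrac_sum => v _.
    rewrite -[_ - _]addr0; apply: hfracM; first exact: hfrac_xword_pt.
    by rewrite RWP_embE qact_const; apply: hfrac_const.
  exists a; split=> // v; have := ha2 v; have [_ ->] := rwP w.
  by congr zhomog; ring.
exists (fun v w => a w v); split=> [w|v w]; first by case: (aP w).
have [_ /(_ v) hz] := aP w; split=> hl; first by move: hz; rewrite subzn.
have neg z (p : S) : z < 0 -> zhomog z p -> p = 0 by case: z.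
by apply: neg hz; rewrite subr_lt0 ltz_nat.
Qed.

(** The Schubert class of bar 1 is [pt].  Its coordinate and those of its image have
    the same degree dim_flag, so the coordinates of phi(f_1) have degree 0. *)
Lemma E_D0_sub_E_RW rw phi :
  (forall w : WP, reduced_word (rw w) (val w)) -> E_S phi -> E_D0 rw phi ->
  E_RW phi.
Proof.
move=> rwP [hQ [hS _]] [_ [a [ha1 ha2]]].
have rw1 : rw (bar 1%g) = [::].
  by apply: size0nil; have [_ ->] := rwP (bar 1%g); rewrite val_bar1 len1.
(* bar 1 is the neutral element, so its reduced word is empty *)
have hpt : schubert (rw (bar 1%g)) = pt.
  by rewrite rw1 /Defs.schubert big_nil odot1.
have hc v : hfrac 0 (phi fone v).
  have e : phi fone v = pt_c^-1 * phi pt v.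
    by rewrite pt_fone E_Q_odot // odot_scaleE mulKr // pt_coef_unit.
  rewrite e -(addNr (Posz (dim_flag J))); apply: hfracM; first exact: hfrac_pt_coefV.
  rewrite -hpt ha1 sum_ffunE; apply: hfrac_sum => u _; rewrite ffunE.
  have [_ sz] := rwP u; rewrite -[Posz (dim_flag J)](subrK (Posz (size (rw u)))).
  rewrite addrC; apply: hfracM; last exact: hfrac_xword_pt.
  rewrite sz.
  apply: hfrac_emb; have [h _] := ha2 u (bar 1%g).
  by rewrite val_bar1 len1 subn0 in h; apply: h.
have /fin_all_exists [r hr] (v : {w : W | min_rep J w}) :
    exists c : R, phi fone v = emb c%:MP.
  have [|s es] := hS fone _ v.
    by move=> u; rewrite RWP_embE; apply: inS_emb.
  exists (s@_0%MM); rewrite es; congr (emb _).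
  have := hc v; rewrite es => /(zhomog_hfrac two_regular) /= hs.
  apply/mpolyP => m; rewrite mcoeffC; case: (eqVneq 0%MM m) => [<-|m0].
    by rewrite mulr1.
  rewrite mulr0; apply: dhomog_nemf_coeff hs _.
  by rewrite mdeg_eq0 eq_sym.
apply: (@E_RW_of phi [ffun v => r v]) => //.
by apply/ffunP => v; rewrite RWP_embE ffunE hr.
Qed.

(** * Direct summands *)

(** Right convolution by an element invariant under W_P on the left *)
Lemma E_Q_right_mul G : (forall u, u \in WL -> odot (delta 1 u) G = G) ->
  E_Q (fun F => odot (lift F) G).
Proof.
move=> hG; split=> //; split=> [F1 F2 _ _|x F _ _].
  rewrite -[X in lift (_ + X)]opprK.
  have -> : lift (F1 - - F2) = lift F1 - - lift F2.
    by apply/ffunP => w; rewrite !ffunE; case: ifP; rewrite ?ffunE // oppr0 subr0.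
  by rewrite odotBl -[- lift F2]sub0r odotBl -[0](subrr (lift F2)) odotBl subrr sub0r opprK.
apply/ffunP => y.
pose H z := qact z (G (bar (z^-1 * val y)%g)).
have HM z u : u \in WL -> H (z * u)%g = H z.
  move=> uL; rewrite /H -[in RHS](hG u uL) odot_deltaE mul1r qactM bar_mull.
  by rewrite invMg mulgA.
rewrite odot_liftE odotE.
under eq_bigr => v _ do rewrite odotE mulr_suml.
rewrite exchange_big /=; apply: eq_bigr => w _.
rewrite odot_liftE rmorph_sum mulr_sumr /=.
rewrite [RHS](reindex_inj (h := fun v : WP => bar (w^-1 * val v)%g)) /=; last first.
  apply: (can_inj (g := fun v : WP => bar (w * val v)%g)) => v.
  by rewrite bar_mull mulKVg barK.
apply: eq_bigr => v _; rewrite rmorphM /= qactM -mulrA; congr (_ * (_ * _)).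
rewrite bar_mull mulgA -invMg.
have [u uL e] := bar_coset J (w^-1 * val v)%g.
have e2 : (w * bar_val J (w^-1 * val v) = val v * u)%g.
  by rewrite [bar_val _ _]e !mulgA mulgV mul1g.
rewrite e2; exact: esym (HM (val v) u uL).
Qed.

Lemma lift_foneK G : odot (lift fone) G = G.
Proof.
have -> : lift fone = delta 1 1%g; last exact: odot1.
apply/ffunP => w; rewrite [LHS]ffunE [RHS]ffunE foneE; case: (eqVneq w 1%g) => [->|w1].
  by rewrite val_bar1 !eqxx.
case: eqP => // e; case: eqP => // e1; case/eqP: w1.
by rewrite -e e1 val_bar1.
Qed.

End Endomorphisms.

Section Summands.

Variables (R : comNzRingType) (two_regular : forall x : R, 2 * x = 0 -> x = 0).
Variables (Phi : root_datum) (B : base Phi).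
Variables (W : weyl_group Phi) (Q : root_localization R Phi).
Variable J : {set 'I_(b_size B)}.
Local Notation odot := (@odot R Phi B W Q J).
Local Notation permact := (@permact R Phi B W J).
Local Notation inD := (@inD R Phi W Q).
Local Notation RWP := (RWP R W J).
Local Notation RWP_emb := (@RWP_emb R Phi B W Q J).
Local Notation RWP1 := (RWP1 R W J).
Local Notation pt := (pt_class W Q J).
Local Notation bar := (@bar _ B W J).

Variables N1 N2 : RWP -> Prop.
Hypotheses (sub1 : submodule permact (fun=> True) (fun=> True) N1)
           (sub2 : submodule permact (fun=> True) (fun=> True) N2)
           (cap : forall f, N1 f -> N2 f -> f = 0).

Lemma summand_eq g1 g2 h1 h2 : N1 g1 -> N1 g2 -> N2 h1 -> N2 h2 ->
  g1 + h1 = g2 + h2 -> g1 = g2.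
Proof.
case: sub1 sub2 => _ [_ [B1 _]] [_ [_ [B2 _]]] n1 n2 m1 m2 e.
have e' : g1 - g2 = h2 - h1.
  by apply/eqP; rewrite subr_eq addrAC -subr_eq opprK e addrC.
apply/eqP; rewrite -subr_eq0; apply/eqP/cap; first exact: B1.
by rewrite e'; apply: B2.
Qed.

Variables g h : RWP.
Hypotheses (gN : N1 g) (hN : N2 h) (gh : RWP1 = g + h).

Lemma summand_act1 x : N1 (permact x g).
Proof. by case: sub1 => _ [_ [_ H]]; apply: H. Qed.

Lemma summand_act2 x : N2 (permact x h).
Proof. by case: sub2 => _ [_ [_ H]]; apply: H. Qed.

(** If f_1 = g + h, the projection to the first summand maps f_1 to g. *)
Definition summand_proj (F : QWPdual W Q J) : QWPdual W Q J :=
  odot (lift F) (RWP_emb g).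

Lemma summand_proj_E_RW : E_RW summand_proj.
Proof.
apply: (E_RW_of two_regular (r := g)); last exact: lift_foneK.
apply: E_Q_right_mul => u uL.
have xu : xconst Q [ffun w => (w == u)%:R] = delta 1 u :> QW W Q.
  by apply/ffunP => w; rewrite !ffunE; case: eqP; rewrite ?rmorph1 ?rmorph0.
rewrite -xu -RWP_emb_permact; congr RWP_emb.
apply: (summand_eq (summand_act1 _) gN (summand_act2 [ffun w => (w == u)%:R]) hN).
rewrite -(permactD Q two_regular) -gh; apply: (RWP_emb_inj two_regular (Q := Q)).
rewrite RWP_emb_permact xu; apply/ffunP => v.
rewrite odot_deltaE mul1r !foneE -[v in RHS]barK !bar_eq1 groupMl ?groupV //.
by case: ifP; rewrite ?rmorph1 ?rmorph0.
Qed.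

Lemma permact_lift_g : permact (lift g) g = g.
Proof.
case: (sub2) => _ [N0 _].
apply: (summand_eq (summand_act1 _) gN (summand_act2 (lift g)) N0).
by rewrite -(permactD Q two_regular) -gh (permact_lift1 Q two_regular) addr0.
Qed.

Lemma summand_proj_idem F : summand_proj (summand_proj F) = summand_proj F.
Proof.
rewrite {2}/summand_proj (E_Q_odot _ _ summand_proj_E_RW.1); congr odot.
by rewrite /summand_proj -RWP_emb_permact_lift permact_lift_g.
Qed.

Lemma summand_proj_pt G : summand_proj pt = odot (delta (pt_coef Q J) 1%g) G ->
  RWP_emb g = G.
Proof.
rewrite pt_fone (E_Q_odot _ _ summand_proj_E_RW.1) /summand_proj lift_foneK => e.
apply/ffunP => v; apply: (mulrI (pt_coef_unit Q J)).
by rewrite -!odot_scaleE e.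
Qed.

(** The projection preserves D_P^*, which is the direct sum of its image and kernel
    there.  If one of them is 0, then it contains no multiple of f_1, so g or h
    is 0. *)
Lemma summand_trivial :
  indecomposable odot inD (@inDPdual R Phi B W Q J) ->
  (forall f, N1 f -> f = 0) \/ (forall f, N2 f -> f = 0).
Proof.
case=> _ ind; have hP := summand_proj_E_RW; have [[_ [hD hx]] [hDP _]] := E_S_sub_E_D (E_RW_sub_E_S hP).
have pB F G : summand_proj (F - G) = summand_proj F - summand_proj G.
  by apply/eqP; rewrite eq_sym subr_eq -hD // subrK.
have D0 : inDPdual (0 : QWPdual W Q J).
  apply/inDPdualP; rewrite -(subrr pt); apply: int_orbitB; exact: int_orbit_pt.
have DB (F G : QWPdual W Q J) : inDPdual F -> inDPdual G -> inDPdual (F - G).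
  by move=> /inDPdualP hF /inDPdualP hG; apply/inDPdualP/int_orbitB.
have p0 : summand_proj 0 = 0 by rewrite -[X in summand_proj X](subrr 0) pB subrr.
have Dpt : inDPdual pt by apply/inDPdualP/int_orbit_pt.
(* the image and the kernel of the projection on D_P^* , which is idempotent *)
have [||||H|H] := ind (fun F => inDPdual F /\ summand_proj F = F)
                      (fun F => inDPdual F /\ summand_proj F = 0).
- split; first by move=> F [].
  split; first by split.
  split=> [F G [hF eF] [hG eG]|x F xD [hF eF]].
    by split; [apply: DB | rewrite pB eF eG].
  by split; [apply: inDPdual_odot | rewrite hx // eF].
- split; first by move=> F [].
  split; first by split.
  split=> [F G [hF eF] [hG eG]|x F xD [hF eF]].
    by split; [apply: DB | rewrite pB eF eG subrr].
  split; first exact: inDPdual_odot.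
  by rewrite hx // eF -[X in odot _ X](subrr 0) odotBr subrr.
- move=> F hF; exists (summand_proj F), (F - summand_proj F); split; last split.
  + by split; [apply: hDP | apply: summand_proj_idem].
  + by split; [apply/DB => //; apply: hDP | rewrite pB summand_proj_idem subrr].
  by rewrite addrC subrK.
- by move=> F [_ e1] [_ e2]; rewrite -e1.
- left=> f fN; have e0 : RWP_emb g = RWP_emb 0.
    apply: summand_proj_pt; rewrite (H (summand_proj pt)); last first.
      by split; [apply: hDP | apply: summand_proj_idem].
    apply/ffunP => v; rewrite odot_scaleE RWP_embE !ffunE mpolyC0 rmorph0.
    by rewrite mulr0.
  have g0 := RWP_emb_inj two_regular e0.
  apply: cap => //; rewrite -(permact_lift1 Q two_regular f) gh g0 add0r.
  exact: summand_act2.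
- right=> f fN; have e1 : RWP_emb g = RWP_emb RWP1.
    apply: summand_proj_pt; rewrite -pt_fone.
    have := H (pt - summand_proj pt); rewrite pB summand_proj_idem subrr.
    move=> /(_ (conj (DB _ _ Dpt (hDP _ Dpt)) erefl)) /eqP.
    by rewrite subr_eq0 => /eqP.
  have g1 := RWP_emb_inj two_regular e1.
  apply: cap => //; rewrite -(permact_lift1 Q two_regular f) -g1.
  exact: summand_act1.
Qed.

End Summands.

Theorem corollary6p3 :
  (forall (R : comNzRingType) (two_regular : forall x : R, 2 * x = 0 -> x = 0)
     (Phi : root_datum) (B : base Phi) (W : weyl_group Phi)
     (J : {set 'I_(b_size B)}) (Q : root_localization R Phi)
     (rw : WP W J -> seq 'I_(b_size B))
     (rw_reduced : forall w : WP W J, reduced_word (rw w) (val w))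
     (phi : QWPdual W Q J -> QWPdual W Q J),
     E_S phi /\ E_D0 rw phi <-> E_RW phi)
  /\
  (forall (Phi : root_datum) (B : base Phi) (W : weyl_group Phi)
     (J : {set 'I_(b_size B)}) (Q : root_localization int Phi),
     indecomposable (@odot int Phi B W Q J) (@inD int Phi W Q)
       (@inDPdual int Phi B W Q J) ->
     indecomposable (@permact int Phi B W J) (fun=> True) (fun=> True)).
Proof.
split=> [R two_regular Phi B W J Q rw rwP phi|Phi B W J Q ind].
  split=> [[hS hD]|h]; first exact: E_D0_sub_E_RW hS hD.
  by split; [apply: E_RW_sub_E_S | apply: E_RW_sub_E_D0].
have two_regular (x : int) : 2 * x = 0 -> x = 0 by lia.
split.
  exists (RWP1 int W J); split=> // e.
  have := congr1 (fun f : RWP int W J => f (bar J 1%g)) e.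
  by rewrite !ffunE eqxx => /eqP; rewrite oner_eq0.
move=> N1 N2 sub1 sub2 sum cap.
have [//|g [h [gN [hN gh]]]] := sum (RWP1 int W J).
exact: (summand_trivial two_regular sub1 sub2 cap gN hN gh ind).
Qed.
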